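(* Let $x\ge 0$ be a fixed real number. Let $n=n_N$ be integers with $0\le n_N\le N$ such that $u=u_N=\dfrac{Np-n_N}{\sqrt{pqN}}$ remains bounded as $N\to\infty$. Then, with $\varepsilon=1/N$, as $N\to\infty$, $$K_n(x)=\frac{\varepsilon^{1/2}}{\sqrt{2\pi pq}}\left[\sqrt{\frac{q\varepsilon}{p}}\right]^{x}\exp\left[\frac{\pi \mathrm{i}p-q\ln(q)}{\varepsilon}-\frac{u\sqrt{pq}\,[\pi \mathrm{i}+\ln(q)]}{\sqrt{\varepsilon}}-\frac{u^{2}}{4}\right]\bigl[\mathrm{D}_x(u)+o(1)\bigr].$$
   Context: Fix real $0<p,q<1$ with $p+q=1$. For integers $n,N\ge 0$ and real $x$, the Krawtchouk polynomial is $$K_n(x)=K_n(x,N,p,q)=\sum_{k=0}^{n}\binom{x}{k}\binom{N-x}{n-k}q^{k}(-p)^{n-k},$$ where $\binom{a}{k}=a(a-1)\cdots(a-k+1)/k!$ for real $a$ and integer $k\geq 0$. $\mathrm{D}_x(u)$ is the (Whittaker) parabolic cylinder function of order $x$: the solution of $w''+\left(x+\tfrac12-\tfrac{u^2}{4}\right)w=0$ with $\mathrm{D}_x(u)\sim u^{x}e^{-u^2/4}$ as $u\to+\infty$. *)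

(* Defs.v *)
From HB Require Import structures.
From mathcomp Require Import all_boot all_order all_algebra.
From mathcomp Require Import all_classical all_reals all_analysis.
From mathcomp Require Export complex.

Set Implicit Arguments.
Unset Strict Implicit.
Unset Printing Implicit Defensive.

Import Order.TTheory GRing.Theory Num.Theory.
Import numFieldNormedType.Exports.

Local Open Scope classical_set_scope.
Local Open Scope ring_scope.
Local Open Scope complex_scope.

Definition gbinom {R : realType} (a : R) (k : nat) : R :=
  (\prod_(i < k) (a - i%:R)) / k`!%:R.

Definition krawtchouk {R : realType} (p q : R) (N n : nat) (x : R) : R :=
  \sum_(0 <= k < n.+1)
    gbinom x k * gbinom (N%:R - x) (n - k) * q ^+ k * (- p) ^+ (n - k).

(* Only the behaviour at +oo is prescribed: it selects the recessive solution
   of the equation and fixes its normalisation, so at most one w qualifies. *)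
Definition is_parabolic_cylinder {R : realType} (x : R) (w : R -> R) : Prop :=
  [/\ forall u, derivable w u 1,
      forall u, derivable (w^`())%classic u 1,
      forall u, (w^`(2))%classic u + (x + 2^-1 - u ^+ 2 / 4) * w u = 0
    & w u / (u `^ x * expR (- (u ^+ 2 / 4))) @[u --> +oo] --> (1 : R)].

(* D_x, by definite description; the default value 0 is never used, since
   a solution with the prescribed asymptotics exists for every real x. *)
Definition parabolic_cylinder {R : realType} (x : R) : R -> R :=
  xget (fun=> 0) [set w | is_parabolic_cylinder x w].

Definition cexp {R : realType} (z : R[i]) : R[i] :=
  (expR (complex.Re z))%:C * (cos (complex.Im z) +i* sin (complex.Im z)).

(* Main.v *)
Require Import Defs.
From HB Require Import structures.
From mathcomp Require Import all_boot all_order all_algebra.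
From mathcomp Require Import all_classical all_reals all_analysis.
From mathcomp Require Import complex measurable_realfun.
From mathcomp Require Import ring lra zify.
Import Order.TTheory GRing.Theory Num.Theory.
Import numFieldNormedType.Exports.

Local Open Scope classical_set_scope.
Local Open Scope ring_scope.
Local Open Scope complex_scope.

Set Implicit Arguments.
Unset Strict Implicit.
Unset Printing Implicit Defensive.

(** Put h = sqrt (q / (p N)), d = 1 / sqrt (p q N) and n = N p - u / d.  In real
    terms the exponential of the statement is (-1)^n q^-(N-n) e^(-u^2/4), and
    the claim is that the normalised value kappa N x of the Krawtchouk
    polynomial differs from D_x(u) by o(1).

    Contour integration is avoided by moving x.  The generating function
    (1+qz)^x (1-pz)^(N-x) gives a three-term recurrence in x ([krawtchouk_rec]),
    whose rescaled form ([kappa_rec]) is a perturbation, of size O(d), of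
    D_{x+1} = u D_x - x D_{x-1}.  If the claim holds at x - 1 and at x, it holds
    at x + 1 ([kappa_step]), so it suffices to prove it at every x <= -2.

    There, with nu = -x, all terms of the defining sum have the same sign and
      K_n(-nu) = (-1)^n p^n binom(N+nu, n) sum_k (nu)_k/k! rho_k,
    where rho_k is close to exp(-u s - s^2/2) for s = k d.  Since (nu)_k/k! is
    close to k^(nu-1)/Gamma(nu), the sum is a Riemann sum of
      (1/Gamma(nu)) int_0^oo s^(nu-1) exp(-u s - s^2/2) ds = e^(u^2/4) D_{-nu}(u),
    and dominated convergence applied to the step function with cells of width d
    gives the limit ([riemann_sum_cvg]).  The prefactor is the local de
    Moivre-Laplace theorem ([local_limit]), deduced from Stirling's formula
    ([stirling_lim]), together with binom(N+nu, n) / binom(N, n) -> q^-nu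
    ([gbinom_ratio]).

    The functions obtained from the integral by the recurrence satisfy a first
    order system, hence the Weber equation, and have the required behaviour at
    +oo ([pcf_spec]).  Two solutions with this behaviour coincide
    ([parabolic_unique]), which identifies them with D_x. *)

(** * The three-term recurrence in x *)

Section GeneralizedBinomial.
Context {R : realType}.
Implicit Types (a x : R) (k n m N : nat).

Lemma gbinom0 a : gbinom a 0 = 1.
Proof. by rewrite /gbinom big_ord0 fact0 divr1. Qed.

Lemma gbinomS a k : k.+1%:R * gbinom a k.+1 = (a - k%:R) * gbinom a k.
Proof.
rewrite /gbinom big_ord_recr /= factS natrM.
have h1 : (k.+1%:R : R) != 0 by rewrite pnatr_eq0.
have h2 : (k`!%:R : R) != 0 by rewrite pnatr_eq0 -lt0n fact_gt0.
by field; rewrite h2 -natr1 addrC in h1 *.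
Qed.

(** Both sides are (k+1) times the coefficient with index k + 1. *)
Lemma gbinom_absorb a k : a * gbinom (a - 1) k = (a - k%:R) * gbinom a k.
Proof.
elim: k => [|k IH]; first by rewrite !gbinom0 subr0.
have h1 : (k.+1%:R : R) != 0 by rewrite pnatr_eq0.
apply: (mulfI h1).
rewrite mulrCA gbinomS mulrCA [RHS]mulrCA gbinomS IH -natr1.
by ring.
Qed.

Lemma gbinom_pascal a k : gbinom (a + 1) k.+1 = gbinom a k.+1 + gbinom a k.
Proof.
have h1 : (k.+1%:R : R) != 0 by rewrite pnatr_eq0.
apply: (mulfI h1); rewrite mulrDr !gbinomS.
have := gbinom_absorb (a + 1) k; rewrite addrK => <-.
by rewrite -natr1; ring.
Qed.

End GeneralizedBinomial.

Section Recurrence.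
Context {R : realType} (p q : R) (pq1 : p + q = 1).

(** With F_x(z) = (1+qz)^x (1-pz)^(N-x), one has F_{x+1} = F_x (1 + z/(1-pz)) and
    F_{x-1} = F_x (1 - z/(1+qz)), so p(N-x) F_{x+1} + xq F_{x-1} is
    (p(N-x) + xq) F_x - z F_x'.  The proof compares coefficients of z^n. *)
Lemma krawtchouk_rec (N n : nat) (x : R) :
  p * (N%:R - x) * krawtchouk p q N n (x + 1) =
  (p * N%:R - p * x + q * x - n%:R) * krawtchouk p q N n x
  - x * q * krawtchouk p q N n (x - 1).
Proof.
pose a k := gbinom x k * q ^+ k.
pose b j := gbinom (N%:R - x) j * (- p) ^+ j.
have aS k : k.+1%:R * a k.+1 = q * (x - k%:R) * a k.
  by rewrite /a mulrA gbinomS exprS; ring.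
have bS j : j.+1%:R * b j.+1 = - p * (N%:R - x - j%:R) * b j.
  by rewrite /b mulrA gbinomS exprS; ring.
have KE : krawtchouk p q N n x = \sum_(0 <= k < n.+1) a k * b (n - k)%N.
  by apply: eq_bigr => k _; rewrite /a /b; ring.
have NS j : (N%:R - x) * gbinom (N%:R - (x + 1)) j =
    (N%:R - x - j%:R) * gbinom (N%:R - x) j.
  by rewrite -gbinom_absorb; congr (_ * gbinom _ _); ring.
have NP j : gbinom (N%:R - (x - 1)) j.+1 =
    gbinom (N%:R - x) j.+1 + gbinom (N%:R - x) j.
  by rewrite -gbinom_pascal; congr (gbinom _ _); ring.
have xP k : gbinom (x + 1) k.+1 = gbinom x k.+1 + gbinom x k.
  exact: gbinom_pascal.
case: n KE => [|m] KE.
  by rewrite /krawtchouk !big_nat1 !subnn !gbinom0; ring.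
(* T, TJ and TK are the sums of a_k b_j over k + j = n with weights 1, j and k;
   U1 and U2 are the corresponding weighted sums over k + j = n - 1. *)
pose U1 := \sum_(0 <= k < m.+1) (N%:R - x - (m - k)%:R) * (a k * b (m - k)%N).
pose U2 := \sum_(0 <= k < m.+1) (x - k%:R) * (a k * b (m - k)%N).
set T := krawtchouk p q N m.+1 x in KE *.
pose TJ := \sum_(0 <= k < m.+2) (m.+1 - k)%:R * (a k * b (m.+1 - k)%N).
pose TK := \sum_(0 <= k < m.+2) k%:R * (a k * b (m.+1 - k)%N).
have TJK : TJ + TK = m.+1%:R * T.
  rewrite KE big_distrr /= /TJ /TK -big_split /=; apply: eq_big_nat => k.
  by rewrite ltnS => /andP[_ kn]; rewrite -mulrDl -natrD subnK.
have TJE : TJ = - p * U1.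
  rewrite /TJ big_nat_recr //= subnn mul0r addr0 /U1 big_distrr /=.
  apply: eq_big_nat => k; rewrite ltnS => /andP[_ kn].
  by rewrite subSn // mulrCA bS; ring.
have TKE : TK = q * U2.
  rewrite /TK big_nat_recl //= mul0r add0r /U2 big_distrr /=.
  by apply: eq_big_nat => k _; rewrite subSS mulrA aS; ring.
have E1 : (N%:R - x) * krawtchouk p q N m.+1 (x + 1) =
    (N%:R - x) * T - TJ + q * U1.
  pose c k := gbinom (N%:R - x) (m.+1 - k) * (- p) ^+ (m.+1 - k) *
    (N%:R - x - (m.+1 - k)%:R) : R.
  have -> : (N%:R - x) * krawtchouk p q N m.+1 (x + 1) =
      \sum_(0 <= k < m.+2) gbinom (x + 1) k * q ^+ k * c k.
    rewrite /krawtchouk big_distrr /=; apply: eq_bigr => k _.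
    transitivity (gbinom (x + 1) k * q ^+ k * (- p) ^+ (m.+1 - k) *
      ((N%:R - x) * gbinom (N%:R - (x + 1)) (m.+1 - k))); first by ring.
    by rewrite NS /c; ring.
  have -> : \sum_(0 <= k < m.+2) gbinom (x + 1) k * q ^+ k * c k =
      \sum_(0 <= k < m.+2) gbinom x k * q ^+ k * c k +
      \sum_(0 <= k < m.+1) gbinom x k * q ^+ k.+1 * c k.+1.
    rewrite [LHS]big_nat_recl // [X in _ = X + _]big_nat_recl // !gbinom0 -addrA.
    congr (_ + _); rewrite -big_split /=.
    by apply: eq_bigr => k _; rewrite xP !mulrDl.
  congr (_ + _).
    rewrite KE big_distrr /= /TJ -sumrB; apply: eq_bigr => k _.
    by rewrite /c /a /b; ring.
  rewrite /U1 big_distrr /=; apply: eq_bigr => k _.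
  by rewrite /c /a /b subSS exprS; ring.
have E2 : x * krawtchouk p q N m.+1 (x - 1) = x * T - TK - p * U2.
  pose c k := gbinom x k * q ^+ k * (x - k%:R) : R.
  have -> : x * krawtchouk p q N m.+1 (x - 1) =
      \sum_(0 <= k < m.+2) c k * gbinom (N%:R - (x - 1)) (m.+1 - k)
         * (- p) ^+ (m.+1 - k).
    rewrite /krawtchouk big_distrr /=; apply: eq_bigr => k _.
    transitivity (x * gbinom (x - 1) k * q ^+ k *
      gbinom (N%:R - (x - 1)) (m.+1 - k) * (- p) ^+ (m.+1 - k)); first by ring.
    by rewrite gbinom_absorb /c; ring.
  rewrite big_nat_recr //= subnn gbinom0.
  rewrite (eq_big_nat _ _ (F2 := fun k => c k * b (m.+1 - k)%N
     + c k * (- p * b (m - k)%N))); last first.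
    move=> k; rewrite ltnS => /andP[_ kn].
    by rewrite subSn // NP exprS /b exprS; ring.
  have -> : c m.+1 * 1 * (- p) ^+ 0 = c m.+1 * b (m.+1 - m.+1)%N.
    by rewrite subnn /b gbinom0; ring.
  rewrite big_split /= addrAC.
  rewrite -(big_nat_recr m.+1 0%N (fun k => c k * b (m.+1 - k)%N)) //=.
  congr (_ + _).
    rewrite KE big_distrr /= /TK -sumrB; apply: eq_bigr => k _.
    by rewrite /c /a; ring.
  rewrite /U2 big_distrr /= -sumrN; apply: eq_bigr => k _.
  by rewrite /c /a; ring.
rewrite -mulrA E1 [x * q]mulrC -mulrA E2.
have q1 : q = 1 - p by rewrite -pq1; ring.
have -> : (p * N%:R - p * x + q * x - m.+1%:R) * T =
  (p * N%:R - p * x + q * x) * T - (TJ + TK) by rewrite TJK; ring.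
by rewrite TJE TKE q1; ring.
Qed.

End Recurrence.
(** * Integrals over the half line *)

Section HalfLineIntegrals.
Context {R : realType}.
Notation mu := (@lebesgue_measure R).
Notation half := (`[0, +oo[%classic : set R).

Lemma within_half_continuous (f : R -> R) :
  continuous f -> {within half, continuous f}.
Proof. by move=> cf; apply: continuous_subspaceT. Qed.

Lemma within_half_measurable (f : R -> R) :
  {within half, continuous f} -> measurable_fun half f.
Proof. by apply: subspace_continuous_measurable_fun; exact: measurable_itv. Qed.

Lemma cvg_expR_half : expR (- (s / 2)) @[s --> +oo%R] --> (0 : R).
Proof.
apply: (@cvg_comp _ _ _ (fun s : R => s / 2) (fun s => expR (- s)) _ +oo%R).
  exact: gt0_cvgMly.
exact: cvgr_expR.
Qed.

Lemma derive_exp_half (s : R) :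
  is_derive s 1 (fun s => - (2 * expR (- (s / 2)))) (expR (- (s / 2))).
Proof.
by apply: is_derive_eq; rewrite /GRing.scale /=; field.
Qed.

Lemma continuous_exp_half : continuous (fun s : R => expR (- (s / 2))).
Proof.
move=> s; apply: (@continuous_comp _ _ _ (fun s : R => - (s / 2)) expR).
  by apply: continuousN; apply: mulrr_continuous.
exact: continuous_expR.
Qed.

Lemma integral_exp_half :
  (\int[mu]_(s in half) (expR (- (s / 2)))%:E = 2%:E)%E.
Proof.
rewrite (@ge0_continuous_FTC2y _ _ (fun s => - (2 * expR (- (s / 2)))) _ 0).
- by rewrite mul0r oppr0 expR0 mulr1 -EFinN opprK -EFinD add0r.
- by move=> *; exact: expR_ge0.
- by apply: within_half_continuous; exact: continuous_exp_half.
- rewrite [X in _ --> X](_ : 0 = - (2 * 0)); last by rewrite mulr0 oppr0.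
  apply: cvgN; apply: cvgMl_tmp.
  exact: cvg_expR_half.
- by move=> s _; have := derive_exp_half s; case.
- apply: cvg_at_right_filter.
  by apply: cvgN; apply: cvgMl_tmp; apply: continuous_exp_half.
- by move=> s _; rewrite derive1E; have := derive_exp_half s; case.
Qed.

Lemma integrable_exp_half (C : R) :
  mu.-integrable half (EFin \o (fun s => C * expR (- (s / 2)))).
Proof.
have mI : measurable (half : set (measurableTypeR R)) by exact: measurable_itv.
have : mu.-integrable half (EFin \o (fun s => expR (- (s / 2)))).
  apply/integrableP; split.
    apply/measurable_EFinP; apply: within_half_measurable.
    by apply: within_half_continuous; exact: continuous_exp_half.
  under eq_integral do rewrite /= ger0_norm ?expR_ge0//.
  by rewrite integral_exp_half ltry.
by move=> iE; have := @integrableZl _ _ _ mu half mI C _ iE.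
Qed.

(** All integrands below are compared with a multiple of e^(-s/2). *)
Lemma integrable_dominated (f : R -> R) (C : R) :
  measurable_fun half f ->
  (forall s, 0 <= s -> `|f s| <= C * expR (- (s / 2))) ->
  mu.-integrable half (EFin \o f).
Proof.
move=> mf fC; apply: (le_integrable _ _ _ (integrable_exp_half C)).
- exact: measurable_itv.
- exact/measurable_EFinP.
- move=> s; rewrite /= in_itv/= andbT => s0.
  by rewrite lee_fin (le_trans (fC s s0))// ler_norm.
Qed.

(** Adding C e^(-s/2) makes the integrand nonnegative, which reduces the claim to
    the fundamental theorem for nonnegative functions. *)
Lemma FTC_half_line (f F : R -> R) (C l : R) :
  {within half, continuous f} ->
  (forall s, 0 <= s -> `|f s| <= C * expR (- (s / 2))) ->
  F x @[x --> +oo%R] --> l ->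
  (forall s : R, 0 < s -> is_derive s 1 F (f s)) ->
  F x @[x --> 0^'+] --> F 0 ->
  \int[mu]_(s in half) f s = l - F 0.
Proof.
move=> cf fC Fl dF F0.
have intf := integrable_dominated (within_half_measurable cf) fC.
pose g s := C * expR (- (s / 2)).
pose G s := C * - (2 * expR (- (s / 2))).
have cg : continuous g.
  by move=> s; apply: cvgMl_tmp; exact: continuous_exp_half.
have cG : continuous G.
  move=> s; apply: cvgMl_tmp; apply: cvgN; apply: cvgMl_tmp.
  exact: continuous_exp_half.
have dG (s : R) : is_derive s 1 G (g s).
  by have ? := derive_exp_half s; apply: is_derive_eq; rewrite /GRing.scale /=.
have intg := integrable_exp_half C.
have -> : \int[mu]_(s in half) f s =
    \int[mu]_(s in half) (f s + g s) - \int[mu]_(s in half) g s.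
  by rewrite RintegralD ?addrK//; exact: measurable_itv.
have -> : \int[mu]_(s in half) g s = - G 0.
  have -> : \int[mu]_(s in half) g s =
      C * \int[mu]_(s in half) expR (- (s / 2)).
    rewrite -RintegralZl//; have := integrable_exp_half 1.
    by congr (_.-integrable _ _); apply/funext => s /=; rewrite mul1r.
  rewrite /Rintegral integral_exp_half /=.
  by rewrite /G mul0r oppr0 expR0; ring.
rewrite (@Rintegral_ge0_continuous_FTC2y _ _ (F \+ G) _ l).
- by rewrite /=; ring.
- move=> s s0; have := fC s s0; rewrite ler_norml => /andP[+ _].
  by rewrite -subr_ge0 opprK.
- by move=> s; apply: cvgD; [exact: cf|exact: (within_half_continuous cg)].
- rewrite -[l]addr0; apply: cvgD => //.
  rewrite [X in _ --> X](_ : 0 = C * - (2 * 0)); last first.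
    by rewrite mulr0 oppr0 mulr0.
  by apply: cvgMl_tmp; apply: cvgN; apply: cvgMl_tmp; exact: cvg_expR_half.
- by move=> s s0; have [? _] := dF s s0; have [? _] := dG s; exact: derivableD.
- by apply: cvgD => //; apply: cvg_at_right_filter; exact: cG.
- move=> s; rewrite in_itv/= andbT => s0.
  have ? := dF s s0; have ? := dG s.
  by rewrite derive1E derive_val.
Qed.

End HalfLineIntegrals.
(** * Moments of s^a exp(-u s - c s^2) *)

Section GaussianMoments.
Context {R : realType}.
Notation mu := (@lebesgue_measure R).
Notation half := (`[0, +oo[%classic : set R).
Implicit Types (a c u s K : R).

Definition kern c a u s := s `^ a * expR (- (u * s) - c * s ^+ 2).

(** For c = 0 and u = 1 this is Gamma(a+1); for c = 1/2 it is the integral that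
    represents D_{-(a+1)}(u), up to the factor e^(-u^2/4) / Gamma(a+1). *)
Definition moment c a u := \int[mu]_(s in half) kern c a u s.

(** A lower bound for the exponent that makes the moments converge; K measures
    the loss, and it must not depend on u when u ranges over a bounded set. *)
Definition tame c u K := forall s, 0 <= s -> s - K <= u * s + c * s ^+ 2.

Lemma tame_exp : tame 0 1 0.
Proof. by move=> s _; rewrite subr0 mul1r mul0r addr0. Qed.

Lemma tame_gauss u (M : R) : `|u| <= M -> tame 2^-1 u (2^-1 * (1 + M) ^+ 2).
Proof.
rewrite ler_norml => /andP[uM Mu] s s0.
have := sqr_ge0 (s - (1 + M)); nra.
Qed.

Lemma powR_add1 a s : 0 <= a -> 0 <= s -> s `^ (a + 1) = s * s `^ a.
Proof.
move=> a0 s0; rewrite -(mulr_powRB1 s0 (p := a + 1)) ?addrK//.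
by rewrite ltr_wpDl.
Qed.

Lemma powR_within a : 0 <= a -> {within half, continuous (fun s => s `^ a)}.
Proof.
rewrite le_eqVlt => /predU1P[<-|a0].
  apply: within_half_continuous.
  have -> : (fun s : R => s `^ 0) = cst 1 by apply/funext => s; rewrite powRr0.
  exact: cst_continuous.
apply/continuous_within_itvcyP; split; last first.
  by rewrite powR0 ?gt_eqF//; exact: powR_cvg0.
move=> s s0; apply: differentiable_continuous; apply/derivable1_diffP.
exact: derivable_powR.
Qed.

Lemma continuous_quad_exp c u :
  continuous (fun s : R => expR (- (u * s) - c * s ^+ 2)).
Proof.
move=> s; apply: continuous_comp; last exact: continuous_expR.
apply: cvgB; first by apply: cvgN; apply: cvgMl_tmp; exact: cvg_id.
by apply: cvgMl_tmp; exact: exprn_continuous.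
Qed.

Lemma kern_within c a u : 0 <= a -> {within half, continuous (kern c a u)}.
Proof.
move=> a0 s; apply: cvgM; first exact: powR_within.
exact: (within_half_continuous (@continuous_quad_exp c u)).
Qed.

Lemma kern_ge0 c a u s : 0 <= kern c a u s.
Proof. by rewrite mulr_ge0 ?powR_ge0 ?expR_ge0. Qed.

Definition kern_cst a K : R := (2 * (a + 1)) `^ a * expR K.

Lemma kern_cst_ge0 a K : 0 <= kern_cst a K.
Proof. by rewrite mulr_ge0 ?powR_ge0 ?expR_ge0. Qed.

(** From y <= e^y at y = s / (2 (a + 1)); the shift by 1 covers a = 0. *)
Lemma powR_le_exp a s : 0 <= a -> 0 <= s ->
  s `^ a <= (2 * (a + 1)) `^ a * expR (s / 2).
Proof.
move=> a0 s0.
have b0 : 0 < 2 * (a + 1) by lra.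
have s1 : s <= 2 * (a + 1) * expR (s / (2 * (a + 1))).
  rewrite -ler_pdivrMl // mulrC.
  by apply: le_trans (expR_ge1Dx _); rewrite lerDr.
apply: (@le_trans _ _ ((2 * (a + 1) * expR (s / (2 * (a + 1)))) `^ a)).
  by apply: ge0_ler_powR; rewrite ?nnegrE// mulr_ge0 ?expR_ge0// ltW.
rewrite powRM ?expR_ge0// ?(ltW b0)// ler_wpM2l ?powR_ge0//.
rewrite -expRM ler_expR.
rewrite -mulrA ler_wpM2l//.
rewrite mulrC ler_pdivrMr //; lra.
Qed.

Lemma kern_le c a u K s : tame c u K -> 0 <= a -> 0 <= s ->
  kern c a u s <= kern_cst a K * expR (- (s / 2)).
Proof.
move=> tm a0 s0; rewrite /kern /kern_cst.
apply: (@le_trans _ _ ((2 * (a + 1)) `^ a * expR (s / 2) * expR (K - s))).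
  apply: ler_pM; rewrite ?powR_ge0 ?expR_ge0 ?powR_le_exp//.
  by rewrite ler_expR; have := tm s s0; lra.
rewrite -!mulrA -!expRD.
have -> : s / 2 + (K - s) = K + - (s / 2) by field.
by [].
Qed.

Lemma kern_norm_le c a u K s : tame c u K -> 0 <= a -> 0 <= s ->
  `|kern c a u s| <= kern_cst a K * expR (- (s / 2)).
Proof. by move=> tm a0 s0; rewrite ger0_norm ?kern_ge0 ?(kern_le tm). Qed.

Lemma integrable_kern c a u K : tame c u K -> 0 <= a ->
  mu.-integrable half (EFin \o kern c a u).
Proof.
move=> tm a0; apply: (@integrable_dominated _ _ (kern_cst a K)).
  by apply: within_half_measurable; exact: kern_within.
by move=> s s0; exact: kern_norm_le tm a0 s0.
Qed.

Lemma moment_ge0 c a u : 0 <= moment c a u.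
Proof. by apply: Rintegral_ge0 => s _; exact: kern_ge0. Qed.

Lemma moment_le c a u K : tame c u K -> 0 <= a ->
  moment c a u <= kern_cst a K * 2.
Proof.
move=> tm a0.
have mI : measurable (half : set (measurableTypeR R)).
  exact: measurable_itv.
have ie := integrable_exp_half (kern_cst a K).
have -> : kern_cst a K * 2 =
    \int[mu]_(s in half) (kern_cst a K * expR (- (s / 2))).
  rewrite RintegralZl//; last first.
    have := @integrable_exp_half R 1.
    by congr (_.-integrable _ _); apply/funext => s /=; rewrite mul1r.
  by rewrite /Rintegral integral_exp_half.
apply: le_Rintegral => //; first exact: integrable_kern tm a0.
by move=> s; rewrite /= in_itv /= andbT => s0; exact: kern_le tm a0 s0.
Qed.

Lemma kern_cvgy c a u K : tame c u K -> 0 <= a ->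
  kern c a u s @[s --> +oo%R] --> 0.
Proof.
move=> tm a0.
apply: (@squeeze_cvgr _ _ _ _ (cst 0)
  (fun s => kern_cst a K * expR (- (s / 2)))).
- near=> s.
  have s0 : 0 <= s by near: s; exact: nbhs_pinfty_ge.
  by rewrite kern_ge0 (kern_le tm).
- exact: cvg_cst.
- rewrite [X in _ --> X](_ : 0 = kern_cst a K * 0); last by rewrite mulr0.
  by apply: cvgMl_tmp; exact: cvg_expR_half.
Unshelve. all: by end_near. Qed.

Lemma is_derive_quad_exp c u s :
  is_derive s 1 (fun s => expR (- (u * s) - c * s ^+ 2))
   (- (u + 2 * c * s) * expR (- (u * s) - c * s ^+ 2)).
Proof.
by apply: is_derive_eq; rewrite /GRing.scale /=; ring.
Qed.

Lemma is_derive_kern c a u s : 0 <= a -> 0 < s ->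
  is_derive s 1 (kern c (a + 1) u)
   ((a + 1) * kern c a u s - u * kern c (a + 1) u s
     - 2 * c * kern c (a + 2) u s).
Proof.
move=> a0 s0.
have h1 := is_derive1_powR (a + 1) s0.
have h2 := is_derive_quad_exp c u s.
apply: is_derive_eq; rewrite /GRing.scale /= /kern.
have -> : a + 2 = a + 1 + 1 by ring.
rewrite !powR_add1 ?addrK ?(ltW s0)//; first by ring.
by lra.
Qed.

Lemma within_comb (f g : R -> R) (l m : R) :
  {within half, continuous f} -> {within half, continuous g} ->
  {within half, continuous (fun s => l * f s - m * g s)}.
Proof.
by move=> cf cg s; apply: cvgB; apply: cvgMl_tmp; [exact: cf|exact: cg].
Qed.

(** The integral of the derivative of s^(a+1) exp(-u s - c s^2) vanishes. *)
Lemma moment_rec c a u K : tame c u K -> 0 <= a ->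
  (a + 1) * moment c a u =
  u * moment c (a + 1) u + 2 * c * moment c (a + 2) u.
Proof.
move=> tm a0.
have a1 : 0 <= a + 1 by lra.
have a2 : 0 <= a + 2 by lra.
pose f s := (a + 1) * kern c a u s - u * kern c (a + 1) u s
     - 2 * c * kern c (a + 2) u s.
have i0 := integrable_kern tm a0.
have i1 := integrable_kern tm a1.
have i2 := integrable_kern tm a2.
have mI : measurable (half : set (measurableTypeR R)).
  exact: measurable_itv.
have j0 : mu.-integrable half (EFin \o (fun s => (a + 1) * kern c a u s)).
  by have := integrableZl mI (a + 1) i0.
have j1 : mu.-integrable half (EFin \o (fun s => u * kern c (a + 1) u s)).
  by have := integrableZl mI u i1.
have j2 : mu.-integrable half (EFin \o (fun s => 2 * c * kern c (a + 2) u s)).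
  by have := integrableZl mI (2 * c) i2.
have : \int[mu]_(s in half) f s = 0 - kern c (a + 1) u 0.
  apply: (@FTC_half_line _ _ _ ((a + 1) * kern_cst a K +
    `|u| * kern_cst (a + 1) K + `|2 * c| * kern_cst (a + 2) K)).
  - move=> s; apply: cvgB; last by apply: cvgMl_tmp; exact: kern_within.
    by apply: within_comb; exact: kern_within.
  - move=> s s0; rewrite [leRHS]mulrDl [X in _ <= X + _]mulrDl /f.
    apply: le_trans (ler_normB _ _) _; apply: lerD; last first.
      by rewrite normrM -mulrA ler_wpM2l// (kern_norm_le tm).
    apply: le_trans (ler_normB _ _) _; apply: lerD.
      by rewrite normrM (ger0_norm a1) -mulrA ler_wpM2l// (kern_norm_le tm).
    by rewrite normrM -mulrA ler_wpM2l// (kern_norm_le tm).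
  - exact: kern_cvgy tm _.
  - by move=> s s0; exact: is_derive_kern.
  - by have /continuous_within_itvcyP[] := @kern_within c (a + 1) u a1.
rewrite /kern powR0 ?gt_eqF ?ltr_wpDl// mul0r subrr -/(kern c (a + 1) u).
rewrite /f RintegralB//; last first.
  have := integrableB mI j0 j1.
  by congr (_.-integrable _ _).
rewrite RintegralB// !RintegralZl//.
by move/eqP; rewrite -addrA -opprD subr_eq0 => /eqP.
Qed.

Lemma moment_rec0 c u K : tame c u K ->
  u * moment c 0 u + 2 * c * moment c 1 u = 1.
Proof.
move=> tm.
have i0 := integrable_kern tm (lexx 0).
have i1 := integrable_kern tm ler01.
have mI : measurable (half : set (measurableTypeR R)).
  exact: measurable_itv.
have j0 : mu.-integrable half (EFin \o (fun s => u * kern c 0 u s)).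
  by have := integrableZl mI u i0.
have j1 : mu.-integrable half (EFin \o (fun s => 2 * c * kern c 1 u s)).
  by have := integrableZl mI (2 * c) i1.
pose F s := - expR (- (u * s) - c * s ^+ 2).
have : \int[mu]_(s in half) (u * kern c 0 u s + 2 * c * kern c 1 u s) = 0 - F 0.
  apply: (@FTC_half_line _ _ _ (`|u| * kern_cst 0 K +
    `|2 * c| * kern_cst 1 K)).
  - move=> s; apply: cvgD; apply: cvgMl_tmp; exact: kern_within.
  - move=> s s0; rewrite [leRHS]mulrDl.
    apply: le_trans (ler_normD _ _) _; apply: lerD;
      by rewrite normrM -mulrA ler_wpM2l// (kern_norm_le tm).
  - rewrite -oppr0; apply: cvgN.
    have -> : (fun x => expR (- (u * x) - c * x ^+ 2)) = kern c 0 u.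
      by apply/funext => s; rewrite /kern powRr0 mul1r.
    exact: kern_cvgy tm _.
  - move=> s s0; have h2 := is_derive_quad_exp c u s.
    apply: is_derive_eq; rewrite /kern powRr0 powRr1 ?ltW//; ring.
  - apply: cvgN; apply: cvg_at_right_filter; exact: continuous_quad_exp.
rewrite /F RintegralD// !RintegralZl//.
rewrite -/(moment _ _ _) -/(moment c 1 u) => ->.
by rewrite expr0n /= !mulr0 subr0 oppr0 expR0; ring.
Qed.

End GaussianMoments.
(** * The Gamma function, Gaussian moments and their ratios *)

Section MomentCalculus.
Context {R : realType}.
Notation mu := (@lebesgue_measure R).
Notation half := (`[0, +oo[%classic : set R).
Implicit Types (a b c u s t K : R).

Lemma is_derive_moment a u : 0 <= a ->
  is_derive u 1 (moment 2^-1 a) (- moment 2^-1 (a + 1) u).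
Proof.
move=> a0.
have a1 : 0 <= a + 1 by lra.
have mI : measurable (half : set (measurableTypeR R)).
  exact: measurable_itv.
have dk (x y : R) : is_derive x 1 ((fun x => kern 2^-1 a x)^~ y)
    (- (y * kern 2^-1 a x y)).
  rewrite /kern; apply: is_derive_eq; rewrite /GRing.scale /=; ring.
have pk (x y : R) : 0 <= y -> partial1of2 (fun x => kern 2^-1 a x) x y =
    - kern 2^-1 (a + 1) x y.
  move=> y0; rewrite partial1of2E; have ? := dk x y; rewrite derive_val.
  by rewrite /kern powR_add1// mulrA.
have tm (x : R) : `]u - 1, u + 1[%classic x ->
    tame 2^-1 x (2^-1 * (1 + (`|u| + 1)) ^+ 2).
  rewrite /= in_itv /= => /andP[x1 x2]; apply: tame_gauss.
  rewrite ler_norml; have := ler_norm u; have := ler_norm (- u).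
  by rewrite normrN => h1 h2; apply/andP; split; lra.
have Iu : `]u - 1, u + 1[%classic u by rewrite /= in_itv /=; lra.
pose G s := kern_cst (a + 1) (2^-1 * (1 + (`|u| + 1)) ^+ 2) * expR (- (s / 2)).
have iG := @integrable_exp_half R (kern_cst (a + 1) (2^-1 * (1 + (`|u| + 1)) ^+ 2)).
have G0 s : 0 <= G s by rewrite mulr_ge0 ?expR_ge0 ?kern_cst_ge0.
have i1 (x : R) : `]u - 1, u + 1[%classic x ->
    mu.-integrable half (EFin \o kern 2^-1 a x).
  by move=> /tm tx; exact: integrable_kern tx a0.
have d1 (x y : R) : `]u - 1, u + 1[%classic x -> half y ->
    derivable ((fun x => kern 2^-1 a x)^~ y) x 1.
  by move=> _ _; have [] := dk x y.
have b1 (x y : R) : `]u - 1, u + 1[%classic x -> half y ->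
    `|partial1of2 (fun x => kern 2^-1 a x) x y| <= G y.
  move=> /tm tx; rewrite /= in_itv /= andbT => y0.
  by rewrite pk// normrN; exact: kern_norm_le tx a1 y0.
split.
  exact: (derivable_under_integral mI Iu i1 d1 G0 iG b1).
rewrite -derive1E (differentiation_under_integral mI Iu i1 d1 G0 iG b1).
rewrite (@eq_Rintegral _ _ _ mu _ (fun s => - 1 * kern 2^-1 (a + 1) u s)).
  rewrite RintegralZl// ?mulN1r//.
  exact: integrable_kern (tm u Iu) a1.
by move=> s; rewrite inE /= in_itv /= andbT => s0; rewrite pk// mulN1r.
Qed.

Lemma moment_scale c a u t : 0 <= a -> 0 < t ->
  moment c a u = t `^ (a + 1) * moment (c * t ^+ 2) a (u * t).
Proof.
move=> a0 t0; rewrite /moment.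
pose F (s : R) := t * s.
have dF (s : R) : is_derive s 1 F t.
  by apply: is_derive_eq; rewrite /GRing.scale /= mulr1.
have F' : F^`()%classic = cst t.
  by apply/funext => s; rewrite derive1E; have ? := dF s; rewrite derive_val.
have F0 : F 0 = 0 by rewrite /F mulr0.
have Fc : continuous F by exact: mulrl_continuous.
rewrite /Rintegral -{1}F0.
rewrite (@increasing_ge0_integration_by_substitutiony _ F).
- transitivity (fine (\int[mu]_(x in half)
     (t `^ (a + 1) * kern (c * t ^+ 2) a (u * t) x)%:E)%E).
    congr fine; apply: eq_integral => s.
    rewrite inE /= in_itv /= andbT => s0; congr EFin.
    transitivity (kern c a u (t * s) * t); first by rewrite F'.
    rewrite /kern powRM ?(ltW t0)// powR_add1 ?(ltW t0)//.
    have -> : - (u * (t * s)) - c * (t * s) ^+ 2 =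
      - (u * t * s) - c * t ^+ 2 * s ^+ 2 by ring.
    by ring.
  (* The integral may be infinite: t^(a+1) is taken out in the extended reals,
     and the equality survives the projection to R in each case. *)
  have t1 : 0 < t `^ (a + 1) by exact: powR_gt0.
  have -> : (\int[mu]_(x in half)
      (t `^ (a + 1) * kern (c * t ^+ 2) a (u * t) x)%:E =
      (t `^ (a + 1))%:E *
        \int[mu]_(x in half) (kern (c * t ^+ 2) a (u * t) x)%:E)%E.
    rewrite -ge0_integralZl//.
    - apply/measurable_EFinP; apply: within_half_measurable.
      exact: kern_within.
    - by move=> s _; rewrite lee_fin kern_ge0.
    - by rewrite lee_fin ltW.
  case: (\int[mu]_(x in half) (kern (c * t ^+ 2) a (u * t) x)%:E)%E => [r| |].
  + by [].
  + by rewrite mulry gtr0_sg// mul1e /= mulr0.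
  + by rewrite mulrNy gtr0_sg// mul1e /= mulr0.
- by move=> x y _ _ xy; rewrite /F ltr_pM2l.
- by rewrite F' => s _; exact: cst_continuous.
- by rewrite F'; apply: is_cvg_cst.
- by rewrite F'; apply: is_cvg_cst.
- split; first by move=> s _; have [] := dF s.
  by apply: cvg_at_right_filter; exact: Fc.
- exact: gt0_cvgMry.
- by rewrite F0; exact: kern_within.
- by move=> s _; exact: kern_ge0.
Qed.

(** g a is Gamma(a+1). *)
Local Notation g a := (@moment R 0 a 1).

Lemma Gamma_rec a : 0 <= a -> g (a + 1) = (a + 1) * g a.
Proof.
move=> a0; have := moment_rec tame_exp a0.
by rewrite mulr0 mul0r addr0 mul1r => ->.
Qed.

Lemma Gamma1 : g 0 = 1.
Proof.
have := moment_rec0 (@tame_exp R).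
by rewrite mulr0 mul0r addr0 mul1r.
Qed.

(** Bernoulli's inequalities: real powers of X lie above their tangents at 1. *)
Lemma powR_tangent_neg b (X : R) : 0 <= b -> 0 < X ->
  1 - b * (X - 1) <= X `^ (- b).
Proof.
move=> b0 X0; rewrite /powR gt_eqF//.
apply: le_trans (expR_ge1Dx _); rewrite mulNr lerD2l lerN2 ler_wpM2l//.
have := le_ln1Dx (x := X - 1); rewrite addrCA subrr addr0; apply; lra.
Qed.

Lemma powR_tangent b (X : R) : 1 <= b -> 0 <= X ->
  1 + b * (X - 1) <= X `^ b.
Proof.
move=> b1; rewrite le_eqVlt => /predU1P[<-|X0].
  by apply: le_trans (powR_ge0 _ _); lra.
have iX : 0 < X^-1 by rewrite invr_gt0.
have b10 : 0 <= b - 1 by lra.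
have := powR_tangent_neg b10 iX.
have -> : X^-1 `^ (- (b - 1)) = X `^ (b - 1).
  by rewrite -(powR_inv1 (ltW X0)) -powRrM mulN1r opprK.
move=> h.
have -> : X `^ b = X * X `^ (b - 1) by rewrite mulr_powRB1 ?ltW//; lra.
apply: (@le_trans _ _ (X * (1 - (b - 1) * (X^-1 - 1)))); last first.
  by rewrite ler_wpM2l ?(ltW X0)//.
rewrite [leRHS](_ : _ = 1 + b * (X - 1))//.
have Xn : X != 0 by rewrite gt_eqF.
by field.
Qed.

(** A pointwise inequality between powers integrates against e^(-s). *)
Lemma gamma_comb_le a b (l m : R) : 0 <= a -> 0 <= b ->
  (forall s, 0 <= s -> l * s `^ a + m * s `^ (a + 1) <= s `^ b) ->
  l * g a + m * g (a + 1) <= g b.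
Proof.
move=> a0 b0 H.
have a1 : 0 <= a + 1 by lra.
have i0 := integrable_kern tame_exp a0.
have i1 := integrable_kern tame_exp a1.
have ib := integrable_kern tame_exp b0.
have mI : measurable (half : set (measurableTypeR R)).
  exact: measurable_itv.
have j0 : mu.-integrable half (EFin \o (fun s => l * kern 0 a 1 s)).
  by have := integrableZl mI l i0.
have j1 : mu.-integrable half (EFin \o (fun s => m * kern 0 (a + 1) 1 s)).
  by have := integrableZl mI m i1.
rewrite /moment -!RintegralZl// -RintegralD//.
apply: le_Rintegral => //.
  by have := integrableD mI j0 j1.
move=> s; rewrite /= in_itv /= andbT => s0.
by rewrite /kern !mulrA -mulrDl ler_wpM2r ?expR_ge0// H.
Qed.

(** The tangent to X^b at X = 1, with X = s / (a+1), integrates against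
    s^a e^(-s) to g a exactly, because a + 1 is the mean of that density.  The
    companion upper bound uses X^(-b) with X = s / (a+b+1). *)
Lemma gamma_ratio_ge a b : 0 <= a -> 1 <= b ->
  (a + 1) `^ b * g a <= g (a + b).
Proof.
move=> a0 b1; have t0 : 0 < a + 1 by lra.
apply: (@le_trans _ _ ((a + 1) `^ b * (1 - b) * g a +
   (a + 1) `^ b * b / (a + 1) * g (a + 1))).
  rewrite Gamma_rec//.
  rewrite [leRHS](_ : _ = (a + 1) `^ b * g a)//.
  by field; rewrite gt_eqF.
apply: gamma_comb_le => //; first by lra.
move=> s s0.
have -> : s `^ (a + b) = (a + 1) `^ b * ((s / (a + 1)) `^ b * s `^ a).
  rewrite mulrA -powRM ?divr_ge0 ?(ltW t0)// [(a + 1) * _]mulrC divfK ?gt_eqF//.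
  by rewrite mulrC -powRD//; apply/implyP => /eqP ab; lra.
rewrite powR_add1// -!mulrA -mulrDr ler_wpM2l ?powR_ge0//.
rewrite (_ : _ + _ = (1 + b * (s / (a + 1) - 1)) * s `^ a); last first.
  by field; rewrite gt_eqF.
by rewrite ler_wpM2r ?powR_ge0// powR_tangent// divr_ge0// ltW.
Qed.

Lemma gamma_ratio_le a b : 0 <= a -> 1 <= b ->
  g (a + b) <= (a + b + 1) `^ b * g a.
Proof.
move=> a0 b1; have t0 : 0 < a + b + 1 by lra.
have ab0 : 0 <= a + b by lra.
have T0 : 0 < (a + b + 1) `^ b by exact: powR_gt0.
rewrite mulrC -ler_pdivrMr//.
have -> : g (a + b) / (a + b + 1) `^ b =
  (1 + b) / (a + b + 1) `^ b * g (a + b) +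
  - b / (a + b + 1) / (a + b + 1) `^ b * g (a + b + 1).
  rewrite Gamma_rec//; field.
  by rewrite !gt_eqF.
apply: gamma_comb_le => //.
move=> s; rewrite le_eqVlt => /predU1P[<-|s0].
  have n1 : a + b != 0 by rewrite gt_eqF//; lra.
  have n2 : a + b + 1 != 0 by rewrite gt_eqF.
  by rewrite (powR0 n1) (powR0 n2) !mulr0 addr0 powR_ge0.
rewrite powR_add1// ?(ltW s0)//.
have -> : s `^ a = s `^ (a + b) / (a + b + 1) `^ b * (s / (a + b + 1)) `^ (- b).
  have iT : (a + b + 1)^-1 `^ b = ((a + b + 1) `^ b)^-1.
    by rewrite -[X in X `^ b](powR_inv1 (ltW t0)) -powRrM mulN1r powRN.
  rewrite powRN powRM ?invr_ge0 ?(ltW s0) ?(ltW t0)// iT.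
  rewrite powRD; last by rewrite (gt_eqF s0) implybT.
  by field; rewrite !gt_eqF ?powR_gt0.
rewrite (_ : _ + _ = s `^ (a + b) / (a + b + 1) `^ b *
   (1 - b * (s / (a + b + 1) - 1))); last first.
  by field; rewrite !gt_eqF.
rewrite ler_wpM2l ?divr_ge0 ?powR_ge0// powR_tangent_neg ?divr_gt0//.
by lra.
Qed.

Lemma gamma_gt0 a : 1 <= a -> 0 < g a.
Proof.
move=> a1; have := gamma_ratio_ge (lexx 0) a1.
by rewrite !add0r powR1 Gamma1 mulr1; apply: lt_le_trans.
Qed.

Lemma gauss_momentSS (k : nat) :
  moment 2^-1 k.+2%:R 0 = k.+1%:R * moment 2^-1 k%:R 0 :> R.
Proof.
have tm : tame 2^-1 (0 : R) (2^-1 * (1 + 0) ^+ 2).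
  by apply: tame_gauss; rewrite normr0.
have := moment_rec tm (ler0n R k).
have -> : 2 * 2^-1 = 1 :> R by rewrite divff ?pnatr_eq0.
rewrite natr1 mul0r add0r mul1r.
have -> : k%:R + 2 = k.+2%:R :> R by rewrite -natrD addn2.
by move=> ->.
Qed.

Lemma gauss_moment1 : moment 2^-1 1 0 = 1 :> R.
Proof.
have tm : tame 2^-1 (0 : R) (2^-1 * (1 + 0) ^+ 2).
  by apply: tame_gauss; rewrite normr0.
by have := moment_rec0 tm; rewrite mul0r add0r divff ?pnatr_eq0// mul1r.
Qed.

Lemma gauss_moment0 : moment 2^-1 0 0 = Num.sqrt (pi / 2) :> R.
Proof.
have s2 : 0 < Num.sqrt 2 :> R by rewrite sqrtr_gt0.
rewrite (@moment_scale _ _ _ (Num.sqrt 2))// add0r powRr1 ?(ltW s2)//.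
rewrite mul0r sqr_sqrtr// mulVf ?pnatr_eq0//.
rewrite /moment /Rintegral.
have -> : (\int[mu]_(x in half) (kern 1 0 0 x)%:E =
    \int[mu]_(x in half) (gauss_fun x)%:E)%E.
  apply: eq_integral => s _.
  by rewrite /kern /gauss_fun powRr0 mul0r oppr0 sub0r !mul1r.
rewrite integral0y_gauss /= mulrCA.
rewrite [RHS]sqrtrM ?pi_ge0// sqrtrV//; congr (_ * _).
by rewrite -[X in _ / X](@sqr_sqrtr _ 2)// expr2 invfM mulrA divff ?mul1r// gt_eqF.
Qed.

(** Log-convexity of the moments, from (s - t)^2 >= 0 with t = sqrt (k+1). *)
Lemma gauss_moment_ratio (k : nat) :
  moment 2^-1 k.+1%:R 0 <= Num.sqrt k.+1%:R * moment 2^-1 k%:R 0 :> R.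
Proof.
have tm : tame 2^-1 (0 : R) (2^-1 * (1 + 0) ^+ 2).
  by apply: tame_gauss; rewrite normr0.
pose t : R := Num.sqrt k.+1%:R.
have t0 : 0 < t by rewrite sqrtr_gt0.
have t2 : t ^+ 2 = k.+1%:R by rewrite sqr_sqrtr.
have mI : measurable (half : set (measurableTypeR R)).
  exact: measurable_itv.
have i0 := integrable_kern tm (ler0n R k).
have i1 := integrable_kern tm (ler0n R k.+1).
have i2 := integrable_kern tm (ler0n R k.+2).
have j0 : mu.-integrable half (EFin \o (fun s => t ^+ 2 * kern 2^-1 k%:R 0 s)).
  by have := integrableZl mI (t ^+ 2) i0.
have j1 : mu.-integrable half (EFin \o (fun s => 2 * t * kern 2^-1 k.+1%:R 0 s)).
  by have := integrableZl mI (2 * t) i1.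
have : 2 * t * moment 2^-1 k.+1%:R 0 <=
    moment 2^-1 k.+2%:R 0 + t ^+ 2 * moment 2^-1 k%:R 0 :> R.
  rewrite /moment -!RintegralZl// -RintegralD//.
  apply: le_Rintegral => //.
    by have := integrableD mI i2 j0.
  move=> s; rewrite /= in_itv /= andbT => s0.
  rewrite /kern !powR_mulrn// !exprS !mulrA -mulrDl ler_wpM2r ?expR_ge0//.
  rewrite [leRHS](_ : _ = (s ^+ 2 + t ^+ 2) * s ^+ k); last by ring.
  rewrite ler_wpM2r ?exprn_ge0//.
  by have := sqr_ge0 (s - t); lra.
rewrite gauss_momentSS t2 -/t => h.
have : t * moment 2^-1 k.+1%:R 0 <= t * (t * moment 2^-1 k%:R 0) :> R.
  by rewrite mulrA -expr2 t2; lra.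
by rewrite ler_pM2l.
Qed.

End MomentCalculus.
(** * Stirling's formula *)

Section Stirling.
Context {R : realType}.
Implicit Types (x y : R).

Lemma is_derive_addl (c y : R) : is_derive y 1 (fun z => c + z) 1.
Proof.
have := @is_deriveD _ _ _ (cst c) id y 1 0 1 (is_derive_cst _ _ _) (is_derive_id _ _).
by rewrite add0r.
Qed.

Lemma is_derive_ln1D y : -1 < y ->
  is_derive y 1 (fun y => ln (1 + y)) ((1 + y)^-1).
Proof.
move=> y1; have y0 : 0 < 1 + y by lra.
have h : is_derive (1 + y) 1 (@ln R) ((1 + y)^-1) by exact: is_derive1_ln.
have := @is_derive1_comp _ (@ln R) (fun y => 1 + y) y _ _ h (is_derive_addl 1 y).
by rewrite mulr1.
Qed.

Lemma ler_from0 (f df : R -> R) x :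
  (forall y, 0 <= y -> is_derive y 1 f (df y)) ->
  (forall y, 0 <= y -> 0 <= df y) -> 0 <= x -> f 0 <= f x.
Proof.
move=> fd dfp; rewrite le_eqVlt => /predU1P[<-//|x0].
have [||c] := @MVT _ f df 0 x x0.
- by move=> y; rewrite in_itv/= => /andP[/ltW y0 _]; exact: fd.
- apply: derivable_within_continuous => y; rewrite in_itv/= => /andP[y0 _].
  by have [] := fd y y0.
rewrite in_itv/= => /andP[/ltW c0 _] E.
by rewrite -subr_ge0 E subr0 mulr_ge0 ?(dfp _ c0) ?(ltW x0).
Qed.

Lemma ln1D_ge x : 0 <= x -> 2 * x / (2 + x) <= ln (1 + x).
Proof.
move=> x0.
pose f y := ln (1 + y) - 2 * y / (2 + y).
have f0 : f 0 = 0 by rewrite /f addr0 ln1 mulr0 mul0r subrr.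
suff : f 0 <= f x by rewrite f0 subr_ge0.
apply: (@ler_from0 f (fun y => y ^+ 2 / ((1 + y) * (2 + y) ^+ 2)) x _ _ x0) => y y0; last first.
  by rewrite divr_ge0 ?sqr_ge0// mulr_ge0 ?sqr_ge0//; lra.
have h : -1 < y by lra.
have y2 : 2 + y != 0 by rewrite gt_eqF//; lra.
have y3 : 1 + y != 0 by rewrite gt_eqF//; lra.
have h1 := is_derive_ln1D h.
have h2 : is_derive y 1 (fun y => (2 + y)^-1) (- (2 + y) ^- 2 * 1).
  have h3 : is_derive y 1 (fun y => 2 + y) 1.
    exact: is_derive_addl.
  by apply: is_deriveV.
apply: is_derive_eq; rewrite /GRing.scale /=.
by field; rewrite y2 y3.
Qed.

Lemma ln1D_le x : 0 <= x -> ln (1 + x) <= x * (2 + x) / (2 * (1 + x)).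
Proof.
move=> x0.
pose f y := y * (2 + y) / 2 * (1 + y)^-1 - ln (1 + y).
have -> : x * (2 + x) / (2 * (1 + x)) = x * (2 + x) / 2 * (1 + x)^-1.
  by rewrite invfM !mulrA.
have f0 : f 0 = 0 by rewrite /f !addr0 ln1 !mul0r subrr.
suff : f 0 <= f x by rewrite f0 subr_ge0.
apply: (@ler_from0 f (fun y => y ^+ 2 / (2 * (1 + y) ^+ 2)) x _ _ x0) => y y0; last first.
  by rewrite divr_ge0 ?sqr_ge0// mulr_ge0 ?sqr_ge0//; lra.
have h : -1 < y by lra.
have y3 : 1 + y != 0 by rewrite gt_eqF//; lra.
have h1 := is_derive_ln1D h.
have h2 : is_derive y 1 (fun y => (1 + y)^-1) (- (1 + y) ^- 2 * 1).
  have h3 : is_derive y 1 (fun y => 1 + y) 1.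
    exact: is_derive_addl.
  by apply: is_deriveV.
apply: is_derive_eq; rewrite /GRing.scale /=.
by field; rewrite y3.
Qed.

(** For y >= 0 this combines the two bounds on the logarithm; for y < 0 they are
    used at x = -y/(1+y). *)
Lemma xlnx_quad y : -1 < y ->
  `|(1 + y) * ln (1 + y) - (y + y ^+ 2 / 2)| <= `|y| ^+ 3 / 2.
Proof.
move=> y1.
have t0 : 0 < 1 + y by lra.
have t2 : 0 < 2 + y by lra.
have [y0|y0] := leP 0 y.
  have H1 := ln1D_ge y0; have H2 := ln1D_le y0.
  rewrite (ger0_norm y0) ler_norml; apply/andP; split.
    apply: (@le_trans _ _ ((1 + y) * (2 * y / (2 + y)) - (y + y ^+ 2 / 2))).
      rewrite -subr_ge0 (_ : _ - _ = y ^+ 4 / (2 * (2 + y)) +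
        y ^+ 3 / (2 * (2 + y))).
        by rewrite addr_ge0// divr_ge0 ?exprn_ge0//; lra.
      by field; rewrite gt_eqF.
    by rewrite lerD2r ler_pM2l.
  apply: (@le_trans _ _ ((1 + y) * (y * (2 + y) / (2 * (1 + y))) - (y + y ^+ 2 / 2))).
    by rewrite lerD2r ler_pM2l.
  rewrite (_ : _ - _ = 0); first by rewrite divr_ge0 ?exprn_ge0.
  by field; rewrite gt_eqF.
(* the substitution 1 + y = 1 / (1 + x) exchanges both signs of y *)
pose x := - y / (1 + y).
have x0 : 0 <= x by rewrite divr_ge0// ?oppr_ge0 ltW.
have E : 1 + x = (1 + y)^-1 by rewrite /x; field; rewrite gt_eqF.
have H1 := ln1D_ge x0; have H2 := ln1D_le x0.
have lE : ln (1 + x) = - ln (1 + y) by rewrite E lnV.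
rewrite lE lerNr in H1; rewrite lE lerNl in H2.
rewrite (ltr0_norm y0) ler_norml; apply/andP; split.
  apply: (@le_trans _ _ ((1 + y) * (- (x * (2 + x) / (2 * (1 + x)))) - (y + y ^+ 2 / 2))).
    rewrite (_ : _ - _ = 0).
      by rewrite oppr_le0 divr_ge0// exprn_ge0//; lra.
    by rewrite /x; field; rewrite !gt_eqF//=; lra.
  by rewrite lerD2r ler_pM2l.
apply: (@le_trans _ _ ((1 + y) * (- (2 * x / (2 + x))) - (y + y ^+ 2 / 2))).
  by rewrite lerD2r ler_pM2l.
rewrite -subr_ge0 (_ : _ - _ = (- y) ^+ 3 * (1 + y) / (2 * (2 + y))).
  by rewrite divr_ge0 ?mulr_ge0 ?exprn_ge0//; lra.
by rewrite /x; field; rewrite !gt_eqF//=; lra.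
Qed.

Definition stirling (n : nat) : R :=
  ln n`!%:R - (n%:R + 2^-1) * ln n%:R + n%:R.

(** The bounds on ln (1 + x) at x = 1/(n+1) make stirling decrease; since
    stirling n - 1/(4n) increases, stirling is bounded below. *)
Lemma stirling_step (n : nat) :
  0 <= stirling n.+1 - stirling n.+2 <= 4^-1 * (n.+1%:R^-1 - n.+2%:R^-1).
Proof.
set m : R := n.+1%:R.
have m0 : 0 < m by rewrite ltr0n.
have m_scaled : n.+2%:R = m + 1 :> R by rewrite /m natr1.
have i0 : 0 <= m^-1 by rewrite invr_ge0 ltW.
have m1 : 0 < 1 + m^-1 by rewrite ltr_wpDr.
have lE : ln (m + 1) = ln m + ln (1 + m^-1).
  rewrite -lnM ?posrE//.
  by rewrite mulrDr mulr1 divff ?gt_eqF.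
have -> : stirling n.+1 - stirling n.+2 = (m + 2^-1) * ln (1 + m^-1) - 1.
  rewrite /stirling [n.+2`!]factS natrM lnM ?posrE ?ltr0n ?fact_gt0// m_scaled lE -/m.
  by field.
rewrite m_scaled subr_ge0; apply/andP; split.
  apply: (@le_trans _ _ ((m + 2^-1) * (2 * m^-1 / (2 + m^-1)))).
    rewrite le_eqVlt; apply/orP; left; apply/eqP; field.
    by rewrite !gt_eqF//; lra.
  by rewrite ler_pM2l ?ln1D_ge//; lra.
rewrite lerBlDr.
apply: (@le_trans _ _ ((m + 2^-1) * (m^-1 * (2 + m^-1) / (2 * (1 + m^-1))))).
  by rewrite ler_pM2l ?ln1D_le//; lra.
rewrite le_eqVlt; apply/orP; left; apply/eqP; field.
by rewrite !gt_eqF//; lra.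
Qed.

Lemma stirling_cvg : cvgn stirling.
Proof.
suff: cvgn (fun n => stirling n.+1).
  move=> h; apply/cvg_ex; exists (limn (fun n => stirling n.+1)).
  by rewrite -(cvg_shiftS stirling).
apply: nonincreasing_is_cvgn.
  apply/nonincreasing_seqP => n.
  by rewrite -subr_ge0; have /andP[] := stirling_step n.
exists (stirling 1 - 4^-1) => _ [n _ <-].
suff: stirling 1 - 4^-1 <= stirling n.+1 - 4^-1 * n.+1%:R^-1.
  have : 0 <= 4^-1 * n.+1%:R^-1 :> R by rewrite mulr_ge0 ?invr_ge0.
  by move=> h1 h2; rewrite (le_trans h2)// lerBlDr lerDl.
elim: n => [|n IH]; first by rewrite invr1 mulr1.
apply: le_trans IH _; have /andP[_] := stirling_step n.
move: (n.+1%:R^-1) (n.+2%:R^-1) (stirling n.+1) (stirling n.+2) => a b c d; lra.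
Qed.

Lemma gauss_moment_odd k : moment 2^-1 k.*2.+1%:R 0 = (2 ^ k * k`!)%:R :> R.
Proof.
elim: k => [|k IH]; first by rewrite gauss_moment1.
rewrite doubleS gauss_momentSS IH -natrM factS expnS; congr _%:R.
by rewrite -doubleS -mul2n; ring.
Qed.

Lemma gauss_moment_even k :
  moment 2^-1 k.*2%:R 0 * (2 ^ k * k`!)%:R = (k.*2)`!%:R * Num.sqrt (pi / 2) :> R.
Proof.
elim: k => [|k IH]; first by rewrite gauss_moment0 mulr1 mul1r.
rewrite doubleS gauss_momentSS.
have -> : (2 ^ k.+1 * k.+1`! = k.*2.+2 * (2 ^ k * k`!))%N.
  by rewrite factS expnS -doubleS -mul2n; ring.
rewrite 2!factS !natrM -!natrM [_%:R * moment _ _ _]mulrC.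
rewrite natrM mulrACA mulrC.
transitivity (k.*2.+2%:R * k.*2.+1%:R * (moment 2^-1 k.*2%:R 0 * (2 ^ k * k`!)%:R) : R).
  by ring.
by rewrite IH !natrM; ring.
Qed.

Lemma stirling_double (k : nat) : (0 < k)%N ->
  expR (2 * (2 * stirling k - stirling k.*2)) =
  (2 ^ k * k`!)%:R ^+ 4 / (k.*2)`!%:R ^+ 2 * 2 / k%:R.
Proof.
move=> k0.
have f1 : 0 < k`!%:R :> R by rewrite ltr0n fact_gt0.
have f2 : 0 < (k.*2)`!%:R :> R by rewrite ltr0n fact_gt0.
have kR : 0 < k%:R :> R by rewrite ltr0n.
have A0 : 0 < (2 ^ k * k`!)%:R :> R by rewrite ltr0n muln_gt0 expn_gt0 fact_gt0.
set RHS := (X in _ = X).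
have R0 : 0 < RHS by rewrite /RHS !divr_gt0 ?mulr_gt0 ?exprn_gt0 ?invr_gt0 ?exprn_gt0.
rewrite -[RHS]lnK ?posrE//; congr expR.
rewrite /RHS !lnM ?posrE ?mulr_gt0 ?invr_gt0 ?exprn_gt0//.
rewrite !lnV ?posrE ?exprn_gt0// !lnXn// natrM lnM ?posrE// ?natrX ?exprn_gt0//.
rewrite lnXn// /stirling -mul2n natrM lnM ?posrE//.
rewrite -[ln 2 *+ k]mulr_natr.
move: (ln (2 * k)%N`!%:R) => c; by field.
Qed.

(** Wallis' estimate: consecutive Gaussian moments m_k satisfy
    m_{k+1} <= sqrt(k+1) m_k, and m_{2k}, m_{2k+1} are explicit. *)
Lemma stirling_double_bounds (k : nat) :
  (2 * pi : R) <= expR (2 * (2 * stirling k.+1 - stirling k.+1.*2)) <=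
  2 * pi + pi * k.+1%:R^-1.
Proof.
rewrite stirling_double//.
have := gauss_moment_ratio (R := R) k.+1.*2.
have := gauss_moment_ratio (R := R) k.+1.*2.+1.
have := gauss_moment_even k.+1.
rewrite gauss_momentSS gauss_moment_odd.
have : 0 < (2 ^ k.+1 * k.+1`!)%:R :> R.
  by rewrite ltr0n muln_gt0 expn_gt0 fact_gt0.
have : 0 < (k.+1.*2)`!%:R :> R by rewrite ltr0n fact_gt0.
have -> : k.+1.*2.+2%:R = 2 * (k.+1%:R + 1) :> R.
  by rewrite -mul2n -addn2 natrD natrM; ring.
have -> : k.+1.*2.+1%:R = 2 * k.+1%:R + 1 :> R.
  by rewrite -mul2n -addn1 natrD natrM.
have x0 : 0 < k.+1%:R :> R by rewrite ltr0n.
move: (moment _ _ _) (_%:R) ((k.+1.*2)`!%:R) (k.+1%:R) x0 => me A F x x0.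
move=> F0 A0 E H1 H2.
have pi0 := pi_gt0 R.
pose S : R := Num.sqrt (pi / 2).
have S2 : S ^+ 2 = pi / 2 by rewrite sqr_sqrtr// divr_ge0// ltW.
have S0 : 0 < S by rewrite sqrtr_gt0 divr_gt0.
have up : A ^+ 4 <= (2 * x + 1) * F ^+ 2 * (pi / 2).
  have : A ^+ 2 <= Num.sqrt (2 * x + 1) * (F * S).
    by rewrite -E mulrA expr2 ler_pM2r.
  move=> h.
  have := @lerXn2r R 2 _ _ _ _ h.
  rewrite !nnegrE sqr_ge0 !mulr_ge0 ?sqrtr_ge0// ?(ltW F0) ?(ltW A0)// => /(_ isT isT).
  rewrite -exprM !exprMn sqr_sqrtr ?S2 ?mulrA//; lra.
have lo : (2 * x + 1) ^+ 2 * F ^+ 2 * (pi / 2) <= 2 * (x + 1) * A ^+ 4.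
  have : (2 * x + 1) * (F * S) <= Num.sqrt (2 * (x + 1)) * A ^+ 2.
    by rewrite -E mulrA expr2 mulrA ler_pM2r.
  move=> h.
  have := @lerXn2r R 2 _ _ _ _ h.
  rewrite !nnegrE !mulr_ge0 ?sqrtr_ge0 ?sqr_ge0// ?(ltW F0) ?(ltW S0) ?(ltW A0)//; last by lra.
  move=> /(_ isT isT).
  by rewrite !exprMn S2 sqr_sqrtr -?exprM ?mulrA//; lra.
have F2 : 0 < F ^+ 2 by rewrite exprn_gt0.
pose B := A ^+ 4 / F ^+ 2.
have BE : A ^+ 4 = B * F ^+ 2 by rewrite divfK// gt_eqF.
have up' : B <= (2 * x + 1) * (pi / 2).
  by rewrite -(ler_pM2r F2) -BE mulrAC.
have lo' : (2 * x + 1) ^+ 2 * (pi / 2) <= 2 * (x + 1) * B.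
  rewrite -(ler_pM2r F2) [leLHS]mulrAC.
  by apply: le_trans lo _; rewrite BE mulrA.
rewrite -/B; apply/andP; split.
  rewrite ler_pdivlMr//.
  have x1 : 0 < 2 * (x + 1) by lra.
  suff : pi * x <= B by lra.
  rewrite -(ler_pM2l x1); apply: le_trans lo'.
  rewrite -subr_ge0 (_ : _ - _ = pi / 2); first by rewrite divr_ge0// ltW.
  by field.
rewrite ler_pdivrMr// mulrDl -[pi * _ * _]mulrA mulVf ?gt_eqF//; lra.
Qed.

(** The limit L exists by monotonicity, and 2 stirling k - stirling (2k) tends
    to L as well as to ln (2 pi) / 2. *)
Lemma stirling_lim : stirling n @[n --> \oo] --> ln (2 * pi : R) / 2.
Proof.
have [L cL] := (cvg_ex _).1 stirling_cvg.
suff -> : ln (2 * pi) / 2 = L :> R by [].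
pose X (k : nat) : R := expR (2 * (2 * stirling k.+1 - stirling k.+1.*2)).
have cX1 : X k @[k --> \oo] --> expR (2 * (2 * L - L)).
  apply: (@continuous_cvg _ R R _ _
    (fun k => 2 * (2 * stirling k.+1 - stirling k.+1.*2)) (@expR R)).
    exact: continuous_expR.
  apply: cvgMl_tmp; apply: cvgB.
    by apply: cvgMl_tmp; rewrite (cvg_shiftS stirling).
  apply: (@cvg_comp _ _ _ (fun k => k.+1.*2) stirling _ \oo) => //.
  apply/cvgnyPge => A; near=> k.
  have : (A <= k)%N by near: k; exact: nbhs_infty_ge.
  by move=> /leq_trans; apply; rewrite -addnn addnS; lia.
have cX2 : X k @[k --> \oo] --> 2 * pi.
  apply: (@squeeze_cvgr _ _ _ _ (cst (2 * pi)) (fun k => 2 * pi + pi * harmonic k)).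
  - by near=> k; exact: stirling_double_bounds.
  - exact: cvg_cst.
  - rewrite -[X in _ --> X]addr0 -(mulr0 pi); apply: cvgD; first exact: cvg_cst.
    by apply: cvgMl_tmp; exact: cvg_harmonic.
have := cvg_unique _ cX1 cX2 => /(_ (@Rhausdorff R)) <-.
by rewrite expRK; field.
Unshelve. all: by end_near. Qed.

End Stirling.
(** * Rising factorials *)

Section RisingFactorials.
Context {R : realType}.
Implicit Types (a nu x s t : R) (k m n : nat).
Local Notation g a := (@moment R 0 a 1).

(** The coefficient (nu)_k / k! of the series of (1 - t)^(-nu). *)
Definition rise nu k : R := (-1) ^+ k * gbinom (- nu) k.

Lemma rise0 nu : rise nu 0 = 1.
Proof. by rewrite /rise gbinom0 mulr1. Qed.

Lemma riseS nu k : k.+1%:R * rise nu k.+1 = (nu + k%:R) * rise nu k.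
Proof. by rewrite /rise mulrCA gbinomS exprS; ring. Qed.

Lemma gamma_nat k : g k%:R = k`!%:R.
Proof.
elim: k => [|k IH]; first by rewrite Gamma1.
by rewrite -natr1 Gamma_rec// IH natr1 factS natrM.
Qed.

Lemma rise_gamma a k : 0 <= a -> rise (a + 1) k * g a * k`!%:R = g (k%:R + a).
Proof.
move=> a0; elim: k => [|k IH]; first by rewrite rise0 mul1r mulr1 add0r.
rewrite -[in RHS]natr1 addrAC Gamma_rec ?addr_ge0// -IH factS natrM.
transitivity (k.+1%:R * rise (a + 1) k.+1 * g a * k`!%:R); first by ring.
by rewrite riseS; ring.
Qed.

Lemma rise_ge a k : 1 <= a -> (k%:R + 1) `^ a <= rise (a + 1) k * g a.
Proof.
move=> a1; have f0 : 0 < k`!%:R :> R by rewrite ltr0n fact_gt0.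
rewrite -(ler_pM2r f0) rise_gamma; last by lra.
by rewrite -gamma_nat; exact: gamma_ratio_ge.
Qed.

Lemma rise_le a k : 1 <= a -> rise (a + 1) k * g a <= (k%:R + a + 1) `^ a.
Proof.
move=> a1; have f0 : 0 < k`!%:R :> R by rewrite ltr0n fact_gt0.
rewrite -(ler_pM2r f0) rise_gamma; last by lra.
by rewrite -gamma_nat; exact: gamma_ratio_le.
Qed.

Lemma gbinom_diag x n : n.+1%:R * gbinom (x + 1) n.+1 = (x + 1) * gbinom x n.
Proof. by rewrite gbinomS -gbinom_absorb addrK. Qed.

Lemma gbinom_rise nu m n :
  gbinom ((m + n)%:R + nu) n * rise (nu + 1) m =
  'C(m + n, n)%:R * rise (nu + 1) (m + n).
Proof.
elim: n => [|n IH]; first by rewrite gbinom0 addn0 bin0.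
have h1 : (n.+1%:R : R) != 0 by rewrite pnatr_eq0.
apply: (mulfI h1); rewrite [LHS]mulrA [RHS]mulrA.
have -> : (m + n.+1)%:R + nu = (m + n)%:R + nu + 1 by rewrite addnS -natr1; ring.
rewrite gbinom_diag -[LHS]mulrA IH addnS -natrM -mul_bin_diag natrM /=.
rewrite [RHS](_ : _ = 'C(m + n, n)%:R * ((m + n).+1%:R * rise (nu + 1) (m + n).+1)).
  by rewrite riseS; ring.
by ring.
Qed.

Lemma powR_diff_le a s t : 1 <= a -> 0 <= s -> s <= t -> 0 < t ->
  t `^ a - s `^ a <= a * (t - s) * t `^ (a - 1).
Proof.
move=> a1 s0 st t0.
have := powR_tangent a1 (divr_ge0 s0 (ltW t0)) => h.
have ta : 0 < t `^ a by exact: powR_gt0.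
have E : s `^ a = t `^ a * (s / t) `^ a.
  by rewrite -powRM ?divr_ge0 ?(ltW t0)// mulrC divfK// gt_eqF.
have T : t `^ a = t * t `^ (a - 1) by rewrite mulr_powRB1 ?(ltW t0)//; lra.
rewrite E.
apply: (@le_trans _ _ (t `^ a - t `^ a * (1 + a * (s / t - 1)))).
  by rewrite lerD2l lerN2 ler_wpM2l// ltW.
rewrite T le_eqVlt; apply/orP; left; apply/eqP.
by field; rewrite gt_eqF.
Qed.

End RisingFactorials.

(** * The ratios of consecutive terms *)

Section RatioEstimates.
Context {R : realType} (p q : R) (hp : 0 < p) (hq : 0 < q) (pq1 : p + q = 1).
Context (nu u d M : R) (hnu : 0 <= nu) (d0 : 0 < d) (uM : `|u| <= M).
Implicit Types (i k : nat).

(** With y = u d + i d^2, the ratio of the terms of index i + 1 and i in the sum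
    for K_n(-nu), apart from the rising factorials, is close to 1 - y.  Summing y
    over i < k gives u s + s^2/2 for s = k d, up to O(d). *)
Definition tilt i : R := u * d + i%:R * d ^+ 2.

Definition term_ratio i : R :=
  (1 - q * tilt i) / (1 + p * tilt i + (nu + 1) * p * d ^+ 2).

Definition ratio_prod k : R := \prod_(i < k) term_ratio i.

Let p1 : p < 1. Proof. by move: hq pq1; lra. Qed.
Let q1 : q < 1. Proof. by move: hp pq1; lra. Qed.

Let nd : 0 <= (nu + 1) * p * d ^+ 2.
Proof. by rewrite !mulr_ge0 ?sqr_ge0 ?addr_ge0// ltW. Qed.

(** 1 - y/(1+py) <= exp(-y/(1+py)), and (1-qy)/(1+py) = 1 - y/(1+py) since
    p + q = 1; the lower bound is the same inequality for the inverse. *)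
Lemma term_ratio_le i : 0 < 1 + p * tilt i -> 0 <= 1 - q * tilt i ->
  term_ratio i <= expR (- (tilt i / (1 + p * tilt i))).
Proof.
move=> D0 n0; apply: (@le_trans _ _ ((1 - q * tilt i) / (1 + p * tilt i))).
  by rewrite ler_wpM2l// lef_pV2 ?posrE ?lerDl// ltr_pwDl.
apply: le_trans (expR_ge1Dx _).
rewrite le_eqVlt; apply/orP; left; apply/eqP.
have -> : q = 1 - p by move: pq1; lra.
by field; rewrite gt_eqF.
Qed.

Lemma term_ratio_ge0 i : 0 < 1 + p * tilt i -> 0 <= 1 - q * tilt i -> 0 <= term_ratio i.
Proof. by move=> D0 n0; rewrite divr_ge0// addr_ge0// ltW. Qed.

Lemma term_ratio_ge i : 0 < 1 + p * tilt i -> 0 < 1 - q * tilt i ->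
  expR (- ((tilt i + (nu + 1) * p * d ^+ 2) / (1 - q * tilt i))) <= term_ratio i.
Proof.
move=> D0 n0.
have D1 : 0 < 1 + p * tilt i + (nu + 1) * p * d ^+ 2 by rewrite ltr_pwDl.
have F0 : 0 < term_ratio i by rewrite divr_gt0.
rewrite expRN -[term_ratio i]invrK lef_pV2 ?posrE ?expR_gt0 ?invr_gt0// /term_ratio invf_div.
apply: le_trans (expR_ge1Dx _).
rewrite le_eqVlt; apply/orP; left; apply/eqP.
have -> : p = 1 - q by move: pq1; lra.
by field; rewrite gt_eqF.
Qed.

Lemma sum_tilt k :
  \sum_(i < k) tilt i = u * (k%:R * d) + ((k%:R * d) ^+ 2 - k%:R * d * d) / 2.
Proof.
elim: k => [|k IH]; first by rewrite big_ord0; field.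
by rewrite big_ord_recr /= IH /tilt -natr1; field.
Qed.

Section Cell.
Context (s : R) (k : nat).
Hypothesis ks : k%:R * d <= s.
Hypothesis sk : s < (k%:R + 1) * d.

Let s0 : 0 <= s. Proof. by apply: le_trans ks; rewrite mulr_ge0// ltW. Qed.

Let M0 : 0 <= M. Proof. exact: le_trans uM. Qed.

Lemma tilt_le i : (i < k)%N -> `|tilt i| <= (M + s) * d.
Proof.
move=> ik; apply: le_trans (ler_normD _ _) _; rewrite mulrDl.
rewrite normrM (gtr0_norm d0) lerD ?ler_wpM2r ?(ltW d0)//.
have t0 : 0 <= i%:R * d ^+ 2 by rewrite mulr_ge0 ?sqr_ge0.
rewrite (ger0_norm t0) expr2 mulrA ler_wpM2r ?(ltW d0)//.
by apply: le_trans ks; rewrite ler_wpM2r ?(ltW d0)// ler_nat ltnW.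
Qed.

(** The first term collects the quadratic errors of at most s / d factors, the
    others the replacement of k d by s. *)
Definition ratio_err : R := s * (2 * (M + s) ^+ 2 + 2 * (nu + 1)) + M + 2 * s.

Lemma ratio_prod_near : (M + s) * d <= 2^-1 ->
  expR (- (u * s) - 2^-1 * s ^+ 2 - ratio_err * d) <= ratio_prod k <=
  expR (- (u * s) - 2^-1 * s ^+ 2 + ratio_err * d).
Proof.
move=> small.
pose E := (2 * (M + s) ^+ 2 + 2 * (nu + 1)) * d ^+ 2.
have Zs i : (i < k)%N -> `|tilt i| <= 2^-1.
  by move=> ik; apply: le_trans (tilt_le ik) small.
have bnd i : (i < k)%N ->
    [/\ 2^-1 <= 1 + p * tilt i, 2^-1 <= 1 - q * tilt i &
     tilt i ^+ 2 <= (M + s) ^+ 2 * d ^+ 2].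
  move=> ik; have := Zs i ik; rewrite ler_norml => /andP[z1 z2]; split.
  - have := hp; have := p1; nra.
  - have := hq; have := q1; nra.
  - rewrite -exprMn -[leLHS]ger0_norm ?sqr_ge0// normrX lerXn2r ?nnegrE//.
      by rewrite mulr_ge0 ?addr_ge0// ltW.
    exact: tilt_le.
have dd : 0 <= d ^+ 2 by exact: sqr_ge0.
have C0 : 0 <= 2 * (M + s) ^+ 2 + 2 * (nu + 1).
  by have := sqr_ge0 (M + s); have := hnu; lra.
have n1 : 0 <= nu + 1 by have := hnu; lra.
have E0 : 0 <= E by rewrite mulr_ge0.
have up i : (i < k)%N -> term_ratio i <= expR (- tilt i + E).
  move=> ik; have [D0 n0 z2] := bnd i ik.
  apply: le_trans (term_ratio_le _ _) _; [lra|lra|rewrite ler_expR].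
  have -> : - (tilt i / (1 + p * tilt i)) = - tilt i + p * tilt i ^+ 2 / (1 + p * tilt i).
    by field; rewrite gt_eqF//; lra.
  rewrite lerD2l ler_pdivrMr; last by lra.
  apply: (@le_trans _ _ (E * 2^-1)); last first.
    by rewrite ler_wpM2l.
  have : p * tilt i ^+ 2 <= tilt i ^+ 2 by rewrite ler_piMl ?sqr_ge0 ?ltW.
  rewrite /E mulrDl -mulrA => h.
  have : 0 <= 2 * (nu + 1) * d ^+ 2 by rewrite mulr_ge0// mulr_ge0.
  by move: z2; lra.
have lo i : (i < k)%N -> expR (- tilt i - E) <= term_ratio i.
  move=> ik; have [D0 n0 z2] := bnd i ik.
  apply: le_trans (term_ratio_ge _ _); [rewrite ler_expR|lra|lra].
  rewrite -opprD lerN2.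
  have -> : (tilt i + (nu + 1) * p * d ^+ 2) / (1 - q * tilt i) =
     tilt i + (q * tilt i ^+ 2 + (nu + 1) * p * d ^+ 2) / (1 - q * tilt i).
    by field; rewrite gt_eqF//; lra.
  rewrite lerD2l ler_pdivrMr; last by lra.
  apply: (@le_trans _ _ (E * 2^-1)); last first.
    by rewrite ler_wpM2l.
  have h1 : q * tilt i ^+ 2 <= tilt i ^+ 2 by rewrite ler_piMl ?sqr_ge0 ?ltW.
  have h2 : (nu + 1) * p * d ^+ 2 <= (nu + 1) * d ^+ 2.
    by rewrite ler_wpM2r// ler_piMr// ltW.
  by rewrite /E mulrDl; move: z2 h1 h2; lra.
have prod_exp (e : R) : \prod_(i < k) expR (- tilt i + e) =
    expR (- (\sum_(i < k) tilt i) + k%:R * e).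
  by rewrite -expR_sum big_split /= sumrN sumr_const card_ord mulr_natl.
have kE : k%:R * E <= s * (2 * (M + s) ^+ 2 + 2 * (nu + 1)) * d.
  rewrite /E; move: C0; set C := (_ + _) => C0.
  have -> : k%:R * (C * d ^+ 2) = k%:R * d * C * d by ring.
  by rewrite ler_wpM2r ?(ltW d0)// ler_wpM2r.
pose x := k%:R * d; have xle : x <= s := ks.
have SZ := sum_tilt k; rewrite -/x in SZ.
have xs : s - x <= d by move: sk; rewrite mulrDl mul1r -/x; lra.
have x0 : 0 <= x by rewrite mulr_ge0// ltW.
have S1 : \sum_(i < k) tilt i <= u * s + 2^-1 * s ^+ 2 + (M + 2 * s) * d.
  rewrite SZ.
  have : u * x <= u * s + M * d.
    have : `|u * (x - s)| <= M * d.
      rewrite normrM ler_pM// ler0_norm; first by lra.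
      by rewrite subr_le0.
    by rewrite ler_norml => /andP[_]; lra.
  have : x ^+ 2 <= s ^+ 2 by rewrite lerXn2r// nnegrE.
  have : 0 <= x * d by rewrite mulr_ge0// ltW.
  have : 0 <= s * d by rewrite mulr_ge0// ltW.
  lra.
have S2 : u * s + 2^-1 * s ^+ 2 - (M + 2 * s) * d <= \sum_(i < k) tilt i.
  rewrite SZ.
  have : u * s - M * d <= u * x.
    have : `|u * (x - s)| <= M * d.
      rewrite normrM ler_pM// ler0_norm; first by lra.
      by rewrite subr_le0.
    by rewrite ler_norml => /andP[+ _]; lra.
  have : s ^+ 2 - x ^+ 2 <= 2 * s * d.
    have -> : s ^+ 2 - x ^+ 2 = (s + x) * (s - x) by ring.
    apply: ler_pM => //; [by rewrite addr_ge0|by rewrite subr_ge0|by lra].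
  have : x * d <= s * d by rewrite ler_wpM2r ?(ltW d0).
  have : 0 <= s * d by rewrite mulr_ge0// ltW.
  lra.
apply/andP; split.
  apply: (@le_trans _ _ (\prod_(i < k) expR (- tilt i - E))).
    rewrite prod_exp ler_expR /ratio_err; lra.
  by apply: ler_prod => i _; rewrite expR_ge0 lo.
apply: (@le_trans _ _ (\prod_(i < k) expR (- tilt i + E))).
  apply: ler_prod => i _; rewrite up// andbT term_ratio_ge0//;
    have [? ? _] := bnd i (ltn_ord i); lra.
rewrite prod_exp ler_expR /ratio_err; lra.
Qed.

Let B : R := 3 / 2 + q^-1.

Let B0 : 0 < B. Proof. by rewrite addr_gt0 ?invr_gt0// divr_gt0. Qed.

(** A bound valid for every s, in particular when y is not small: the denominators
    stay below B, so that each factor is at most exp(2 M d - i d^2 / B). *)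
Lemma ratio_prod_dom : d <= 1 -> M * d <= 2^-1 ->
  (forall i, (i < k)%N -> 0 <= 1 - q * tilt i /\ i%:R * d ^+ 2 <= (p * q)^-1) ->
  0 <= ratio_prod k <= expR (2 * M * s - (2 * B)^-1 * (s ^+ 2 - 3 * s)).
Proof.
move=> d1 small num.
have Md0 : 0 <= M * d by rewrite mulr_ge0// ltW.
have ud : `|u * d| <= M * d by rewrite normrM (gtr0_norm d0) ler_wpM2r// ltW.
have den i : (i < k)%N -> 2^-1 <= 1 + p * tilt i <= B.
  move=> ik; have [_ it] := num i ik.
  move: ud; rewrite ler_norml => /andP[u1 u2].
  have t0 : 0 <= i%:R * d ^+ 2 by rewrite mulr_ge0 ?sqr_ge0.
  rewrite /tilt mulrDr.
  have h1 : - 2^-1 <= p * (u * d) by have := hp; have := p1; nra.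
  have h2 : p * (u * d) <= 2^-1 by have := hp; have := p1; nra.
  have h3 : 0 <= p * (i%:R * d ^+ 2) by rewrite mulr_ge0// ltW.
  have h4 : p * (i%:R * d ^+ 2) <= q^-1.
    by rewrite -ler_pdivlMl// mulrC -invfM mulrC.
  by rewrite /B; apply/andP; split; lra.
have up i : (i < k)%N -> term_ratio i <= expR (2 * (M * d) - i%:R * d ^+ 2 / B).
  move=> ik; have [n0 _] := num i ik; have /andP[D0 D1] := den i ik.
  apply: le_trans (term_ratio_le _ _) _; [lra|by []|rewrite ler_expR].
  rewrite lerNl opprB {1}/tilt [leRHS]mulrDl.
  have D2 : 0 < 1 + p * tilt i by lra.
  have h1 : i%:R * d ^+ 2 / B <= i%:R * d ^+ 2 / (1 + p * tilt i).
    have t0 : 0 <= i%:R * d ^+ 2 by rewrite mulr_ge0 ?sqr_ge0.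
    by rewrite (ler_wpM2l t0)// lef_pV2.
  have h2 : - (2 * (M * d)) <= u * d / (1 + p * tilt i).
    rewrite ler_pdivlMr//.
    move: ud; rewrite ler_norml => /andP[u1 _].
    by apply: le_trans u1; nra.
  lra.
have prod_exp : \prod_(i < k) expR (2 * (M * d) - i%:R * d ^+ 2 / B) =
    expR (2 * M * (k%:R * d) - (2 * B)^-1 * ((k%:R * d) ^+ 2 - k%:R * d * d)).
  rewrite -expR_sum; congr expR.
  elim: (k) => [|j IH].
    by rewrite big_ord0 !mul0r expr0n /= !mulr0 subrr mulr0 subr0.
  by rewrite big_ord_recr /= IH -natr1; field; rewrite gt_eqF// -/B.
have fac0 i : (i < k)%N -> 0 <= term_ratio i.
  move=> ik; have [n0 _] := num i ik; have /andP[D0 D1] := den i ik.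
  by apply: term_ratio_ge0 => //; lra.
apply/andP; split; first by apply: prodr_ge0 => i _; exact: fac0.
apply: (@le_trans _ _ (\prod_(i < k) expR (2 * (M * d) - i%:R * d ^+ 2 / B))).
  by apply: ler_prod => i _; rewrite up// andbT fac0.
rewrite prod_exp ler_expR.
pose x := k%:R * d; have xle : x <= s := ks.
rewrite -/x.
have xs : s - x <= 1 by move: sk; rewrite mulrDl mul1r -/x; lra.
have x0 : 0 <= x by rewrite mulr_ge0// ltW.
apply: lerB; first by rewrite ler_wpM2l// mulr_ge0.
rewrite ler_wpM2l ?invr_ge0 ?mulr_ge0 ?(ltW B0)//.
have : s ^+ 2 - x ^+ 2 <= 2 * s * 1.
  have -> : s ^+ 2 - x ^+ 2 = (s + x) * (s - x) by ring.
  apply: ler_pM => //; [by rewrite addr_ge0|by rewrite subr_ge0|by lra].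
have : x * d <= s * 1 by rewrite ler_pM// ltW.
lra.
Qed.

End Cell.

End RatioEstimates.
(** * Step functions *)

Section StepFunctions.
Context {R : realType}.
Notation mu := (@lebesgue_measure R).
Notation half := (`[0, +oo[%classic : set R).

Lemma dominated_cvg0 (f : nat -> R -> R) (C : R) :
  (\forall N \near \oo, measurable_fun half (f N)) ->
  (\forall N \near \oo, forall s, 0 <= s -> `|f N s| <= C * expR (- (s / 2))) ->
  (forall s, 0 <= s -> f N s @[N --> \oo] --> 0) ->
  \int[mu]_(s in half) f N s @[N --> \oo] --> (0 : R).
Proof.
move=> mf fC f0.
have [N0 _ HN] : \forall N \near \oo, measurable_fun half (f N) /\
    forall s, 0 <= s -> `|f N s| <= C * expR (- (s / 2)).
  by near=> N; split; near: N.
have mI : measurable (half : set (measurableTypeR R)).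
  exact: measurable_itv.
rewrite -(cvg_shiftn N0).
have [] := @dominated_convergence _ _ _ mu half mI
  (fun N s => (f (N + N0)%N s)%:E) (cst 0%E)
  (EFin \o (fun s => C * expR (- (s / 2)))).
- move=> N; apply/measurable_EFinP; apply: (HN (N + N0)%N _).1.
  exact: leq_addl.
- exact: measurable_cst.
- apply: aeW => s; rewrite /= in_itv /= andbT => s0.
  apply: cvg_EFin; first exact: nearW.
  by rewrite (cvg_shiftn N0 (fun N => f N s)); exact: f0.
- exact: integrable_exp_half.
- apply: aeW => s N; rewrite /= in_itv /= andbT => s0.
  rewrite lee_fin; apply: (HN (N + N0)%N _).2 => //; exact: leq_addl.
move=> _ _; rewrite integral0 => h.
exact: (@fine_cvg _ _ _ _ _ (0 : R) h).
Unshelve. all: by end_near. Qed.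

Definition step (d : R) (m : nat) (w : nat -> R) (s : R) : R :=
  \sum_(0 <= k < m) w k * \1_(`[k%:R * d, (k%:R + 1) * d[%classic) s.

Lemma step_integrable d m w :
  mu.-integrable half (EFin \o step d m w).
Proof.
have mI : measurable (half : set (measurableTypeR R)).
  exact: measurable_itv.
elim: m => [|m IH].
  rewrite (_ : _ \o _ = cst 0%E); first exact: integrable0.
  by apply/funext => s; rewrite /= /step big_geq.
have i1 : mu.-integrable half
    (EFin \o (\1_(`[m%:R * d, (m%:R + 1) * d[%classic) : R -> R)).
  apply: (@integrableS _ _ _ mu setT) => //.
  exact: integrable_indic_itv.
have := integrableD mI IH (integrableZl mI (w m) i1).
congr (_.-integrable _ _); apply/funext => s.
by rewrite /= /step big_nat_recr.
Qed.

Lemma Rintegral_step d m w : 0 < d ->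
  \int[mu]_(s in half) step d m w s = \sum_(0 <= k < m) w k * d.
Proof.
move=> d0.
have mI : measurable (half : set (measurableTypeR R)).
  exact: measurable_itv.
elim: m => [|m IH].
  rewrite big_geq// (@eq_Rintegral _ _ _ mu _ (cst 0)); last first.
    by move=> s _; rewrite /step big_geq.
  by rewrite Rintegral_cst// mul0r.
have i1 : mu.-integrable half
    (EFin \o (\1_(`[m%:R * d, (m%:R + 1) * d[%classic) : R -> R)).
  apply: (@integrableS _ _ _ mu setT) => //.
  exact: integrable_indic_itv.
rewrite (@eq_Rintegral _ _ _ mu _ (fun s => step d m w s +
  w m * \1_(`[m%:R * d, (m%:R + 1) * d[%classic) s)); last first.
  by move=> s _; rewrite /step big_nat_recr.
rewrite RintegralD//; last 2 first.
- exact: step_integrable.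
- by have := integrableZl mI (w m) i1.
rewrite IH big_nat_recr//= RintegralZl//; congr (_ + _ * _).
rewrite /Rintegral integral_indic//.
have -> : `[m%:R * d, (m%:R + 1) * d[ `&` half = `[m%:R * d, (m%:R + 1) * d[%classic.
  apply/setIidl => s; rewrite /= !in_itv /= andbT => /andP[h _].
  by apply: le_trans h; rewrite mulr_ge0// ltW.
rewrite /= lebesgue_measure_itv /= lte_fin mulrDl mul1r ltrDl d0 -EFinD /=.
by rewrite addrC addKr.
Qed.

Lemma stepE d m w s : 0 < d -> 0 <= s ->
  (forall k, (m <= k)%N -> w k = 0) ->
  step d m w s = w (Num.truncn (s / d)).
Proof.
move=> d0 s0 wm; set k0 := Num.truncn (s / d).
have sd0 : 0 <= s / d by rewrite divr_ge0// ltW.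
have ind k : \1_(`[k%:R * d, (k%:R + 1) * d[%classic) s = (k == k0)%:R :> R.
  rewrite indicE; congr _%:R; congr nat_of_bool.
  rewrite [RHS]eq_sym /k0 truncn_eq// mem_setE in_itv /=.
  by rewrite ler_pdivlMr// ltr_pdivrMr// natr1.
rewrite /step; under eq_bigr do rewrite ind.
have [km|km] := ltnP k0 m.
  rewrite (bigD1_seq k0) ?mem_index_iota ?iota_uniq//= eqxx mulr1.
  by rewrite big1 ?addr0// => k /negbTE ->; rewrite mulr0.
rewrite (wm _ km) big_nat big1// => k /andP[_ kl].
by rewrite ltn_eqF ?mulr0// (leq_trans kl).
Qed.

End StepFunctions.
(** * Parabolic cylinder functions *)

Section ParabolicCylinder.
Context {R : realType}.
Notation mu := (@lebesgue_measure R).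
Notation half := (`[0, +oo[%classic : set R).
Implicit Types (a c u x : R).
Local Notation g a := (@moment R 0 a 1).

Lemma cvg_inv_sq : (u * u)^-1 @[u --> +oo%R] --> (0 : R).
Proof.
have i1 : u^-1 @[u --> +oo%R] --> (0 : R).
  apply: (@gtr0_cvgV0 R R +oo%R _ id _).2; last exact: cvg_id.
  exact: nbhs_pinfty_gt.
apply: (@squeeze_cvgr _ _ _ _ (cst 0) (fun u => u^-1)) => //; last first.
  exact: cvg_cst.
near=> u; have u1 : 1 <= u by near: u; exact: nbhs_pinfty_ge.
have u0 : 0 < u by lra.
rewrite /= invr_ge0 mulr_ge0 ?(ltW u0)//= lef_pV2 ?posrE ?mulr_gt0//.
by rewrite ler_peMl// ltW.
Unshelve. all: by end_near. Qed.

Definition recessive x (w : R -> R) : Prop :=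
  w u / (u `^ x * expR (- (u ^+ 2 / 4))) @[u --> +oo] --> (1 : R).

(** The first order system satisfied by D_x and D_{x-1}: it implies the Weber
    equation for both, and it is preserved by the recurrence in x. *)
Definition ladder x (f h : R -> R) : Prop :=
  (forall u : R, is_derive u 1 f (x * h u - u / 2 * f u)) /\
  (forall u : R, is_derive u 1 h (u / 2 * h u - f u)).

Lemma ladder_parabolic x f h : ladder x f h -> recessive x f ->
  is_parabolic_cylinder x f.
Proof.
move=> [df dh] rf.
have f' : f^`()%classic = (fun u => x * h u - u / 2 * f u).
  by apply/funext => u; rewrite derive1E; have ? := df u; rewrite derive_val.
have ddf (u : R) : is_derive u 1 f^`()%classic ((u ^+ 2 / 4 - x - 2^-1) * f u).
  rewrite f'; have ? := df u; have ? := dh u.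
  apply: is_derive_eq; rewrite /GRing.scale /=.
  by field.
split=> [u|u|u|//].
- by have [] := df u.
- by have [] := ddf u.
- by rewrite /derive1n /= derive1E; have ? := ddf u; rewrite derive_val; ring.
Qed.

Lemma ladder_step x f h : ladder x f h ->
  ladder (x + 1) (fun u => u * f u - x * h u) f.
Proof.
move=> [df dh]; split => u; have ? := df u; have ? := dh u.
  by apply: is_derive_eq; rewrite /GRing.scale /=; field.
have -> : u / 2 * f u - (u * f u - x * h u) = x * h u - u / 2 * f u by field.
by [].
Qed.

Lemma recessive_step x f h : recessive x f -> recessive (x - 1) h ->
  recessive (x + 1) (fun u => u * f u - x * h u).
Proof.
move=> rf rh.
have i2 := cvg_inv_sq.
rewrite /recessive.
have xi : x * (u * u)^-1 @[u --> +oo%R] --> (x * 0 : R) by exact: cvgMl_tmp.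
have : f u / (u `^ x * expR (- (u ^+ 2 / 4))) - x * (u * u)^-1 *
    (h u / (u `^ (x - 1) * expR (- (u ^+ 2 / 4)))) @[u --> +oo%R] -->
    (1 - x * 0 * 1 : R).
  by apply: cvgB => //; exact: cvgM.
rewrite mulr0 mul0r subr0; apply: cvg_trans; apply: near_eq_cvg; near=> u.
have u0 : 0 < u by near: u; exact: nbhs_pinfty_gt.
have ux : 0 < u `^ x by exact: powR_gt0.
have e0 := expR_gt0 (- (u ^+ 2 / 4)).
have -> : u `^ (x + 1) = u * u `^ x.
  by rewrite powRD ?powRr1 ?(ltW u0) 1?mulrC// (gt_eqF u0) implybT.
have -> : u `^ (x - 1) = u `^ x / u.
  by rewrite powRB ?powRr1 ?(ltW u0)// (gt_eqF u0) implybT.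
by rewrite /=; field; rewrite !gt_eqF.
Unshelve. all: by end_near. Qed.

(** D_{-(a+1)} by its integral representation. *)
Definition pcf_base a u : R := expR (- (u ^+ 2 / 4)) * (moment 2^-1 a u / g a).

Lemma ladder_base a : 1 <= a ->
  ladder (- (a + 1)) (pcf_base a) (pcf_base (a + 1)).
Proof.
move=> a1.
have a0 : 0 <= a by lra.
have a10 : 0 <= a + 1 by lra.
have p1 : 0 < a + 1 by lra.
have dE (u : R) : is_derive u 1 (fun u => expR (- (u ^+ 2 / 4)))
    (- (u / 2) * expR (- (u ^+ 2 / 4))).
  by apply: is_derive_eq; rewrite /GRing.scale /=; field.
have G1 : g (a + 1) = (a + 1) * g a by exact: Gamma_rec.
have ga0 : 0 < g a by exact: gamma_gt0.
have rec u : (a + 1) * moment 2^-1 a u =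
    u * moment 2^-1 (a + 1) u + moment 2^-1 (a + 1 + 1) u.
  rewrite (moment_rec (tame_gauss (lexx `|u|)) a0) divff ?pnatr_eq0// mul1r.
  by rewrite -addrA.
split => u; have ? := dE u; have ? := is_derive_moment u a0;
    have ? := is_derive_moment u a10; rewrite /pcf_base; apply: is_derive_eq;
    rewrite /GRing.scale /= G1.
  move: (moment _ _ _) (moment _ _ _) (g a) (expR _) ga0 => m m' G e G0.
  by field; rewrite !gt_eqF.
have -> : moment 2^-1 a u = (u * moment 2^-1 (a + 1) u +
    moment 2^-1 (a + 1 + 1) u) / (a + 1).
  by rewrite -rec mulrC mulKf// gt_eqF.
move: (moment _ _ _) (moment _ _ _) (g a) (expR _) ga0 => m m' G e G0.
by field; rewrite !gt_eqF.
Qed.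

(** Integrates 1 - c s^2 <= exp(-c s^2) <= 1 against s^a e^(-s). *)
Lemma moment_exp_bounds a c : 0 <= a -> 0 <= c ->
  g a - c * g (a + 2) <= moment c a 1 <= g a.
Proof.
move=> a0 c0.
have a2 : 0 <= a + 2 by lra.
have tm : tame c 1 0.
  by move=> s s0; rewrite subr0 mul1r lerDl mulr_ge0// sqr_ge0.
have i0 := integrable_kern (@tame_exp R) a0.
have i2 := integrable_kern (@tame_exp R) a2.
have ic := integrable_kern tm a0.
have mI : measurable (half : set (measurableTypeR R)).
  exact: measurable_itv.
have j2 : mu.-integrable half (EFin \o (fun s => c * kern 0 (a + 2) 1 s)).
  by have := integrableZl mI c i2.
apply/andP; split.
  rewrite /moment -RintegralZl// -RintegralB//.
  apply: le_Rintegral => //; first by have := integrableB mI i0 j2.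
  move=> s; rewrite /= in_itv /= andbT => s0.
  rewrite /kern !mul0r !subr0.
  have -> : s `^ (a + 2) = s ^+ 2 * s `^ a.
    have -> : a + 2 = a + 1 + 1 by ring.
    by rewrite !powR_add1 ?expr2 ?mulrA//; lra.
  rewrite expRD.
  have h : 1 - c * s ^+ 2 <= expR (- (c * s ^+ 2)) by exact: expR_ge1Dx.
  have -> : s `^ a * expR (- (1 * s)) - c * (s ^+ 2 * s `^ a * expR (- (1 * s))) =
    s `^ a * expR (- (1 * s)) * (1 - c * s ^+ 2) by ring.
  by rewrite mulrA ler_wpM2l// mulr_ge0 ?powR_ge0 ?expR_ge0.
apply: le_Rintegral => // s; rewrite /= in_itv /= andbT => s0.
rewrite /kern ler_wpM2l ?powR_ge0// ler_expR mul0r subr0.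
by rewrite gerBl mulr_ge0// sqr_ge0.
Qed.

(** Rescaling s by 1/u turns the Gaussian factor into exp(-s^2 / (2 u^2)), which
    tends to 1. *)
Lemma recessive_base a : 1 <= a -> recessive (- (a + 1)) (pcf_base a).
Proof.
move=> a1; rewrite /recessive.
have a0 : 0 <= a by lra.
have ga0 : 0 < g a by exact: gamma_gt0.
have i2 := cvg_inv_sq.
have : moment (2^-1 * (u * u)^-1) a 1 / g a @[u --> +oo] --> (1 : R).
  apply: (@squeeze_cvgr _ _ _ _
    (fun u => 1 - 2^-1 * g (a + 2) / g a * (u * u)^-1) (cst 1)).
  - near=> u.
    have u0 : 0 < u by near: u; exact: nbhs_pinfty_gt.
    have c0 : 0 <= 2^-1 * (u * u)^-1 by rewrite mulr_ge0// invr_ge0 mulr_ge0// ltW.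
    have /andP[h1 h2] := moment_exp_bounds a0 c0.
    rewrite /= ler_pdivlMr// ler_pdivrMr// mul1r h2 andbT.
    apply: le_trans h1; rewrite le_eqVlt; apply/orP; left; apply/eqP.
    by field; rewrite !gt_eqF.
  - rewrite -[X in _ --> X]subr0; apply: cvgB; first exact: cvg_cst.
    rewrite -[X in _ --> X](mulr0 (2^-1 * g (a + 2) / g a)).
    exact: cvgMl_tmp.
  - exact: cvg_cst.
apply: cvg_trans; apply: near_eq_cvg; near=> u.
have u0 : 0 < u by near: u; exact: nbhs_pinfty_gt.
have iu : 0 < u^-1 by rewrite invr_gt0.
have ms : moment 2^-1 a u =
    u^-1 `^ (a + 1) * moment (2^-1 * u^-1 ^+ 2) a (u * u^-1).
  exact: moment_scale.
rewrite divff ?gt_eqF// expr2 -invfM in ms.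
rewrite /pcf_base ms.
have -> : u^-1 `^ (a + 1) = u `^ (- (a + 1)).
  by rewrite -(powR_inv1 (ltW u0)) -powRrM mulN1r.
have p0 : 0 < u `^ (- (a + 1)) by exact: powR_gt0.
have e0 := expR_gt0 (- (u ^+ 2 / 4)).
move: (moment _ _ _) (g a) ga0 => m G G0.
by field; rewrite !gt_eqF.
Unshelve. all: by end_near. Qed.

(** The pair (D_x, D_{x-1}) for x = j - (a+1), by the recurrence
    D_{x+1} = u D_x - x D_{x-1}. *)
Fixpoint pcf a (j : nat) : (R -> R) * (R -> R) :=
  if j is j'.+1 then
    let: (f, h) := pcf a j' in (fun u => u * f u - (j'%:R - (a + 1)) * h u, f)
  else (pcf_base a, pcf_base (a + 1)).

Lemma pcf_spec a j (x := j%:R - (a + 1)) : 1 <= a ->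
  [/\ ladder x (pcf a j).1 (pcf a j).2, recessive x (pcf a j).1 &
      recessive (x - 1) (pcf a j).2].
Proof.
move=> a1; rewrite /x {x}; elim: j => [|j].
  rewrite sub0r /=; split; [exact: ladder_base|exact: recessive_base|].
  have -> : - (a + 1) - 1 = - (a + 1 + 1) by ring.
  by apply: recessive_base; lra.
rewrite /=; case: (pcf a j) => f h /= [L rf rh].
have -> : j.+1%:R - (a + 1) = j%:R - (a + 1) + 1 by rewrite -natr1; ring.
split; [exact: ladder_step|exact: recessive_step|by rewrite addrK].
Qed.

End ParabolicCylinder.
(** * Uniqueness of the recessive solution *)

Section Uniqueness.
Context {R : realType}.
Implicit Types (x u : R) (w v z : R -> R).

Lemma recessive_bound x : exists B : R,
  \forall u \near +oo, u `^ x * expR (- (u ^+ 2 / 4)) <= B.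
Proof.
exists ((2 * (`|x| + 1)) `^ `|x| * expR 4^-1).
near=> u.
have u1 : 1 <= u by near: u; exact: nbhs_pinfty_ge.
have u0 : 0 <= u by lra.
apply: (@le_trans _ _ ((2 * (`|x| + 1)) `^ `|x| * expR (u / 2) *
    expR (- (u ^+ 2 / 4)))).
  rewrite ler_wpM2r ?expR_ge0//; apply: le_trans (powR_le_exp _ u0) => //.
  by apply: ler_powR => //; exact: ler_norm.
rewrite -mulrA ler_wpM2l ?powR_ge0// -expRD ler_expR.
by have := sqr_ge0 (u - 1); rewrite sqrrB1 => h; lra.
Unshelve. all: by end_near. Qed.

Lemma derive0_const (f : R -> R) : (forall u : R, is_derive u 1 f 0) ->
  forall u u', f u = f u'.
Proof.
move=> df.
suff H u u' : u < u' -> f u = f u'.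
  by move=> u u'; case: (ltgtP u u') => [/H//|/H//|->].
move=> uu'.
have cf : {within `[u, u'], continuous f}.
  by apply: derivable_within_continuous => y _; have [] := df y.
have [c _] := MVT uu' (fun y _ => df y) cf.
by rewrite mul0r => /eqP; rewrite subr_eq0 => /eqP ->.
Qed.

Definition weber x w := forall u : R,
  is_derive u 1 w (w^`()%classic u) /\
  is_derive u 1 w^`()%classic ((u ^+ 2 / 4 - x - 2^-1) * w u).

Lemma parabolic_weber x w : is_parabolic_cylinder x w -> weber x w.
Proof.
move=> [d1 d2 ode _] u; split.
  by split; [exact: d1|rewrite derive1E].
split; first exact: d2.
have := ode u; rewrite /derive1n /= -derive1E => h; lra.
Qed.

Lemma weberB x w v : weber x w -> weber x v -> weber x (fun u => w u - v u).
Proof.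
move=> Ww Wv.
have E : (fun u => w u - v u)^`()%classic =
    (fun u => w^`()%classic u - v^`()%classic u).
  apply/funext => u; have [? _] := Ww u; have [? _] := Wv u.
  by rewrite derive1E derive_val.
move=> u; have [? ?] := Ww u; have [? ?] := Wv u.
rewrite E; split; apply: is_derive_eq => //.
by rewrite mulrBr.
Qed.

(** Backward uniqueness: with K bounding the coefficients on [t, b], the energy
    (z^2 + z'^2) e^(K u) is nondecreasing there, and it vanishes at b. *)
Lemma weber_zero x z (b : R) : weber x z ->
  z b = 0 -> z^`()%classic b = 0 -> forall t, t <= b -> z t = 0.
Proof.
move=> Wz zb z'b t; rewrite le_eqVlt => /predU1P[->//|tb].
pose Q u := u ^+ 2 / 4 - x - 2^-1.
pose K := 1 + (t ^+ 2 + b ^+ 2) / 4 + `|x| + 2^-1.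
pose E u := (z u ^+ 2 + z^`()%classic u ^+ 2) * expR (K * u).
pose dE u := (2 * z u * z^`()%classic u * (1 + Q u) +
  K * (z u ^+ 2 + z^`()%classic u ^+ 2)) * expR (K * u).
have dEP (u : R) : is_derive u 1 E (dE u).
  have [? ?] := Wz u; apply: is_derive_eq; rewrite /GRing.scale /= /dE /Q.
  by ring.
have cE : {within `[t, b], continuous E}.
  by apply: derivable_within_continuous => y _; have [] := dEP y.
have [c] := MVT tb (fun y _ => dEP y) cE.
rewrite in_itv /= => /andP[tc cb] EE.
have Eb : E b = 0 by rewrite /E zb z'b expr0n /= addr0 mul0r.
have dc : 0 <= dE c.
  rewrite /dE mulr_ge0 ?expR_ge0//.
  have c2 : c ^+ 2 <= t ^+ 2 + b ^+ 2.
    have [c0|c0] := leP 0 c.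
      have : c ^+ 2 <= b ^+ 2 by rewrite lerXn2r// ?nnegrE ?ltW// (le_lt_trans c0).
      by have := sqr_ge0 t; lra.
    have : (- c) ^+ 2 <= (- t) ^+ 2 by rewrite lerXn2r// ?nnegrE; lra.
    by rewrite !sqrrN; have := sqr_ge0 b; lra.
  have QK : `|1 + Q c| <= K.
    rewrite /Q /K ler_norml; have := ler_norm x; have := ler_norm (- x).
    rewrite normrN; have := sqr_ge0 c; have := sqr_ge0 t; have := sqr_ge0 b.
    by move=> *; apply/andP; split; lra.
  move: QK; rewrite ler_norml => /andP[q1 q2].
  have := sqr_ge0 (z c + z^`()%classic c); have := sqr_ge0 (z c - z^`()%classic c).
  move: (1 + Q c) q1 q2 => P q1 q2; rewrite sqrrB sqrrD => h1 h2.
  have K0 : 0 <= K by lra.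
  move: (z c) (z^`()%classic c) h1 h2 => Z Z' h1 h2.
  have [ZZ|ZZ] := leP 0 (Z * Z').
    have : - K * (2 * (Z * Z')) <= P * (2 * (Z * Z')).
      by rewrite ler_wpM2r// mulr_ge0.
    have : 0 <= K * (Z ^+ 2 - Z * Z' *+ 2 + Z' ^+ 2) by rewrite mulr_ge0.
    by nra.
  have : K * (2 * (Z * Z')) <= P * (2 * (Z * Z')).
    by rewrite ler_wnM2r// pmulr_rle0// ltW.
  have : 0 <= K * (Z ^+ 2 + Z * Z' *+ 2 + Z' ^+ 2) by rewrite mulr_ge0.
  by nra.
have Et : E t <= 0.
  have : 0 <= dE c * (b - t) by rewrite mulr_ge0// subr_ge0 ltW.
  by rewrite -EE Eb; lra.
have e0 := expR_gt0 (K * t).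
move: Et; rewrite /E pmulr_lle0// => Et.
have := sqr_ge0 (z t); have := sqr_ge0 (z^`()%classic t) => h1 h2.
by apply/eqP; rewrite -sqrf_eq0; apply/eqP; lra.
Qed.

(** Let z = w - v.  The Wronskian c of z and v is constant, and z/v has derivative
    c / v^2 and limit 0.  As v is bounded near +oo, c <> 0 would make z/v grow
    linearly; so c = 0 and z vanishes near +oo, hence everywhere. *)
Lemma parabolic_unique x w v :
  is_parabolic_cylinder x w -> is_parabolic_cylinder x v -> w = v.
Proof.
move=> Pw Pv.
have Ww := parabolic_weber Pw; have Wv := parabolic_weber Pv.
pose z u := w u - v u.
have Wz : weber x z by exact: weberB.
pose D u := u `^ x * expR (- (u ^+ 2 / 4)).
have rw : w u / D u @[u --> +oo] --> (1 : R) by case: Pw.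
have rv : v u / D u @[u --> +oo] --> (1 : R) by case: Pv.
(* z is negligible with respect to v *)
have rz : z u / v u @[u --> +oo] --> (0 : R).
  have : (w u / D u - v u / D u) / (v u / D u) @[u --> +oo] --> ((1 - 1) / 1 : R).
    by apply: cvgM; [exact: cvgB|apply: cvgV => //; exact: oner_neq0].
  rewrite subrr mul0r; apply: cvg_trans; apply: near_eq_cvg; near=> u.
  have u0 : 0 < u by near: u; exact: nbhs_pinfty_gt.
  have D0 : 0 < D u by rewrite mulr_gt0 ?powR_gt0 ?expR_gt0.
  have vD : 2^-1 < v u / D u by near: u; apply: (cvgr_gt (1 : R)) => //; lra.
  have v0 : 0 < v u.
    have : 0 < v u / D u by lra.
    by rewrite pmulr_lgt0// invr_gt0.
  by rewrite /z; field; rewrite !gt_eqF.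
have [B0 HB] := recessive_bound x.
pose B := 2 * `|B0| + 1.
have B1 : 0 < B by rewrite ltr_wpDl// mulr_ge0.
have vb : \forall u \near +oo, 0 < v u <= B.
  near=> u.
  have u0 : 0 < u by near: u; exact: nbhs_pinfty_gt.
  have D0 : 0 < D u by rewrite mulr_gt0 ?powR_gt0 ?expR_gt0.
  have vD : 2^-1 < v u / D u by near: u; apply: (cvgr_gt (1 : R)) => //; lra.
  have vD' : v u / D u < 2 by near: u; apply: (cvgr_lt (1 : R)) => //; lra.
  have DB : D u <= B0 by near: u.
  rewrite ltr_pdivrMr// in vD'.
  have -> : 0 < v u.
    have : 0 < v u / D u by lra.
    by rewrite pmulr_lgt0// invr_gt0.
  rewrite /=; apply: le_trans (ltW vD') _; rewrite /B.
  by have := ler_norm B0; lra.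
have [U [_ HU]] := vb.
pose W u := z^`()%classic u * v u - z u * v^`()%classic u.
have dW (u : R) : is_derive u 1 W 0.
  have [? ?] := Wz u; have [? ?] := Wv u.
  by apply: is_derive_eq; rewrite /GRing.scale /=; ring.
pose c := W 0.
have Wc u : W u = c by apply: derive0_const.
have dr u : U < u -> is_derive u 1 (fun u => z u / v u) (c / v u ^+ 2).
  move=> Uu; have /andP[v0 _] := HU u Uu.
  have [? ?] := Wz u; have [? ?] := Wv u.
  have vn : v u != 0 by rewrite gt_eqF.
  have ? : is_derive u 1 (fun u => (v u)^-1) (- (v u) ^- 2 * v^`()%classic u).
    exact: is_deriveV.
  apply: is_derive_eq; rewrite /GRing.scale /= -(Wc u) /W.
  by field.
have mvt u1 u2 : U < u1 -> u1 < u2 -> exists2 s, 0 < v s <= B &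
    z u2 / v u2 - z u1 / v u1 = c / v s ^+ 2 * (u2 - u1).
  move=> U1 u12.
  have cr : {within `[u1, u2], continuous (fun u => z u / v u)}.
    apply: derivable_within_continuous => y; rewrite in_itv /= => /andP[y1 _].
    by have [] := dr y (lt_le_trans U1 y1).
  have dr' y : y \in `]u1, u2[ -> is_derive y 1 (fun u => z u / v u) (c / v y ^+ 2).
    by rewrite in_itv /= => /andP[y1 _]; apply: dr; exact: lt_trans y1.
  have [s] := MVT u12 dr' cr.
  rewrite in_itv /= => /andP[s1 _] E; exists s => //.
  by apply: HU; exact: lt_trans s1.
have c0 : c = 0.
  apply/eqP; apply: contraT => cn.
  have c1 : 0 < `|c| / B ^+ 2 by rewrite divr_gt0 ?normr_gt0 ?exprn_gt0.
  have small : \forall u \near +oo, `|z u / v u| < 1.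
    by move/cvgr0Pnorm_lt : rz; apply; exact: ltr01.
  have [V [_ HV]] := small.
  pose u1 : R := `|U| + `|V| + 1.
  have U1 : U < u1 by rewrite /u1; have := ler_norm U; have := normr_ge0 V; lra.
  have V1 : V < u1 by rewrite /u1; have := ler_norm V; have := normr_ge0 U; lra.
  pose L : R := 2 / (`|c| / B ^+ 2).
  have L0 : 0 < L by rewrite divr_gt0.
  have u12 : u1 < u1 + L by rewrite ltrDl.
  have [s /andP[s0 sB]] := mvt u1 (u1 + L) U1 u12.
  have -> : u1 + L - u1 = L by rewrite addrAC subrr add0r.
  move=> E.
  have h1 := HV u1 V1; have h2 := HV (u1 + L) (lt_trans V1 u12).
  have : `|z (u1 + L) / v (u1 + L) - z u1 / v u1| < 2.
    by apply: le_lt_trans (ler_normB _ _) _; move: h1 h2 => /=; lra.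
  rewrite E normrM (gtr0_norm L0) normrM normfV normrX (gtr0_norm s0).
  rewrite ltNge => /negP; case.
  have -> : 2 = `|c| / B ^+ 2 * L by rewrite /L mulrC divfK// gt_eqF.
  rewrite ler_wpM2r ?(ltW L0)// ler_wpM2l// lef_pV2 ?posrE ?exprn_gt0//.
  by rewrite lerXn2r// nnegrE ltW.
have z0 u1 : U < u1 -> z u1 = 0.
  move=> U1; have /andP[v1 _] := HU u1 U1.
  suff : z u1 / v u1 = 0.
    by move=> /eqP; rewrite mulf_eq0 invr_eq0 (gt_eqF v1) orbF => /eqP.
  have cst1 : z u / v u @[u --> +oo] --> z u1 / v u1.
    have : (cst (z u1 / v u1) : R -> R) u @[u --> +oo] --> z u1 / v u1.
      exact: cvg_cst.
    apply: cvg_trans; apply: near_eq_cvg; near=> u2.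
    have u12 : u1 < u2.
      by near: u2; apply: nbhs_pinfty_gt; exact: num_real.
    have [s _] := mvt u1 u2 U1 u12.
    by rewrite c0 mul0r mul0r => /eqP; rewrite subr_eq0 => /eqP ->.
  exact: (cvg_unique _ cst1 rz).
have z'0 u1 : U < u1 -> z^`()%classic u1 = 0.
  move=> U1; rewrite derive1E (@near_eq_derive _ _ _ _ (cst 0)).
  - exact: derive_cst.
  - near=> y; apply: z0; near: y; exact: lt_nbhsr.
apply/funext => u; apply/eqP; rewrite -subr_eq0; apply/eqP.
have Ub : U < `|U| + `|u| + 1.
  by have := ler_norm U; have := normr_ge0 u; lra.
apply: (weber_zero Wz (z0 _ Ub) (z'0 _ Ub)).
by have := ler_norm u; have := normr_ge0 U; lra.
Unshelve. all: by end_near. Qed.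

Lemma parabolic_cylinderE x w :
  is_parabolic_cylinder x w -> parabolic_cylinder x = w.
Proof.
move=> Pw; apply: (parabolic_unique _ Pw).
rewrite /parabolic_cylinder; case: xgetP => [v _ //|].
by move=> /(_ w).
Qed.

End Uniqueness.
(** * The scaling and the local limit theorem *)

Lemma cvg_continuous {R : realType} (f : R -> R) (a : nat -> R) (l : R) :
  f x @[x --> l] --> f l -> a N @[N --> \oo] --> l ->
  f (a N) @[N --> \oo] --> f l.
Proof. by move=> cf al; exact: (cvg_comp a f al cf). Qed.

Lemma cvg0_near {R : realType} (z : nat -> R) (e : R) :
  z N @[N --> \oo] --> 0 -> 0 < e -> \forall N \near \oo, `|z N| <= e.
Proof.
by move=> /cvgr0Pnorm_le z0 e0; exact: z0.
Qed.

Section Setting.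
Context {R : realType} (p q : R) (hp : 0 < p) (hq : 0 < q) (pq1 : p + q = 1).
Context (n : nat -> nat) (hn : forall N, (n N <= N)%N).
Context (u : nat -> R).
Hypothesis hu : forall N,
  u N = (N%:R * p - (n N)%:R) / Num.sqrt (p * q * N%:R).
Context (M : R).
Hypothesis hM : \forall N \near \oo, `|u N| <= M.

Lemma bounded_cvg0 (a b : nat -> R) (B : R) :
  (\forall N \near \oo, `|a N| <= B) -> b N @[N --> \oo] --> 0 ->
  a N * b N @[N --> \oo] --> 0.
Proof.
move=> aB b0; apply/norm_cvg0P.
apply: (@squeeze_cvgr _ _ _ _ (cst 0) (fun N => B * `|b N|)).
- near=> N; rewrite normr_ge0 normrM /=.
  by rewrite ler_wpM2r//; near: N.
- exact: cvg_cst.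
- rewrite -[X in _ --> X](mulr0 B); apply: cvgMl_tmp.
  exact/norm_cvg0P.
Unshelve. all: by end_near. Qed.

(** The width d of the cells. *)
Definition delta (N : nat) : R := (Num.sqrt (p * q * N%:R))^-1.

Lemma pqN_gt0 N : (0 < N)%N -> 0 < p * q * N%:R.
Proof. by move=> N0; rewrite !mulr_gt0// ltr0n. Qed.

Lemma delta_gt0 N : (0 < N)%N -> 0 < delta N.
Proof. by move=> N0; rewrite invr_gt0 sqrtr_gt0 pqN_gt0. Qed.

Lemma delta_sq N : (0 < N)%N -> delta N ^+ 2 = (p * q * N%:R)^-1.
Proof. by move=> N0; rewrite exprVn sqr_sqrtr// ltW// pqN_gt0. Qed.

Lemma delta_sqK N : (0 < N)%N -> p * q * N%:R * delta N ^+ 2 = 1.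
Proof. by move=> N0; rewrite delta_sq// divff// gt_eqF// pqN_gt0. Qed.

Lemma n_scaled N : (0 < N)%N ->
  (n N)%:R = N%:R * p * (1 - q * (u N * delta N)).
Proof.
move=> N0; have pq0 := pqN_gt0 N0.
have -> : u N * delta N = (N%:R * p - (n N)%:R) * delta N ^+ 2.
  by rewrite hu -/(delta N) expr2 mulrA.
rewrite delta_sq//; field.
by rewrite !gt_eqF// ltr0n.
Qed.

Lemma m_scaled N : (0 < N)%N ->
  (N - n N)%:R = N%:R * q * (1 + p * (u N * delta N)).
Proof.
move=> N0; rewrite natrB// n_scaled//.
have -> : q = 1 - p by rewrite -pq1; ring.
by ring.
Qed.

Lemma near_N_gt0 : \forall N \near \oo, (0 < N)%N.
Proof. exact: nbhs_infty_gt. Qed.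

Lemma delta_cvg : delta N @[N --> \oo] --> 0.
Proof.
have h : (p * q)^-1 * N%:R^-1 @[N --> \oo] --> (0 : R).
  rewrite -[X in _ --> X](mulr0 (p * q)^-1); apply: cvgMl_tmp.
  by rewrite -(cvg_shiftS (fun N => N%:R^-1 : R)); exact: cvg_harmonic.
have := cvg_continuous (@sqrt_continuous R 0) h.
rewrite sqrtr0; apply: cvg_trans; apply: near_eq_cvg; near=> N.
have N0 : (0 < N)%N by near: N; exact: near_N_gt0.
by rewrite /= -invfM -delta_sq// sqrtr_sqr ger0_norm// ltW// delta_gt0.
Unshelve. all: by end_near. Qed.

Lemma udelta_cvg : u N * delta N @[N --> \oo] --> 0.
Proof. by apply: (@bounded_cvg0 _ _ M) => //; exact: delta_cvg. Qed.

Lemma scale_cvgy (r : R) (k : nat -> nat) (z : nat -> R) : 0 < r ->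
  z N @[N --> \oo] --> 0 ->
  (\forall N \near \oo, (k N)%:R = N%:R * r * (1 + z N)) ->
  k N @[N --> \oo] --> \oo.
Proof.
move=> r0 z0 kE; apply/(@cvgrnyP R).
apply: (@ger_cvgy _ _ _ _ (fun N => r / 2 * N%:R)); last first.
  have r2 : 0 < r / 2 by rewrite divr_gt0.
  apply: (cvg_comp (fun N : nat => N%:R : R) (fun x => r / 2 * x) cvgr_idn).
  exact: (gt0_cvgMry r2 cvg_id).
near=> N.
have -> : (k N)%:R = N%:R * r * (1 + z N) by near: N.
have : `|z N| <= 2^-1.
  by near: N; apply: cvg0_near => //; rewrite invr_gt0.
rewrite ler_norml => /andP[z1 _].
have : 0 <= N%:R * r by rewrite mulr_ge0// ltW.
have -> : r / 2 * N%:R = (N%:R * r) * 2^-1 by field.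
by move=> h; rewrite ler_wpM2l//; lra.
Unshelve. all: by end_near. Qed.

Lemma n_cvgy : n N @[N --> \oo] --> \oo.
Proof.
apply: (@scale_cvgy p _ (fun N => - q * (u N * delta N))) => //.
  rewrite -[X in _ --> X](mulr0 (- q)); apply: cvgMl_tmp; exact: udelta_cvg.
near=> N; rewrite n_scaled ?mulNr//; near: N; exact: near_N_gt0.
Unshelve. all: by end_near. Qed.

Lemma m_cvgy : (N - n N)%N @[N --> \oo] --> \oo.
Proof.
apply: (@scale_cvgy q _ (fun N => p * (u N * delta N))) => //.
  rewrite -[X in _ --> X](mulr0 p); apply: cvgMl_tmp; exact: udelta_cvg.
near=> N; rewrite m_scaled//; near: N; exact: near_N_gt0.
Unshelve. all: by end_near. Qed.

Lemma ln_near1 (z : nat -> R) : z N @[N --> \oo] --> 0 ->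
  ln (1 + z N) @[N --> \oo] --> 0.
Proof.
move=> z0; rewrite -[X in _ --> X](@ln1 R).
apply: (@cvg_continuous _ (@ln R) (fun N => 1 + z N)).
  exact: continuous_ln.
rewrite -[X in _ --> X]addr0; apply: cvgD => //; exact: cvg_cst.
Qed.

Definition binprob N : R := 'C(N, n N)%:R * p ^+ n N * q ^+ (N - n N).

(** The two expansions (1+y) ln (1+y) = y + y^2/2 + O(y^3) have cancelling linear
    parts, and their quadratic parts add up to u^2/2. *)
Lemma ln_binprob N : (0 < n N)%N -> (0 < N - n N)%N ->
  let y1 := - q * (u N * delta N) in let y2 := p * (u N * delta N) in
  ln (binprob N * Num.sqrt (2 * pi * (p * q * N%:R)) * expR (u N ^+ 2 / 2)) =
  (stirling N - stirling (n N) - stirling (N - n N) + ln (2 * pi) / 2)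
  - ln (1 + y1) / 2 - ln (1 + y2) / 2
  - N%:R * p * ((1 + y1) * ln (1 + y1) - (y1 + y1 ^+ 2 / 2))
  - N%:R * q * ((1 + y2) * ln (1 + y2) - (y2 + y2 ^+ 2 / 2)).
Proof.
move=> n0 m0 y1 y2.
have N0 : (0 < N)%N by exact: leq_trans n0 (hn N).
have NR : 0 < N%:R :> R by rewrite ltr0n.
have nR : 0 < (n N)%:R :> R by rewrite ltr0n.
have mR : 0 < (N - n N)%:R :> R by rewrite ltr0n.
have nE1 : (n N)%:R = N%:R * p * (1 + y1) by rewrite n_scaled// /y1 mulNr.
have mE1 : (N - n N)%:R = N%:R * q * (1 + y2) by rewrite m_scaled.
have Y1 : 0 < 1 + y1.
  by move: nR; rewrite nE1 pmulr_rgt0// mulr_gt0.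
have Y2 : 0 < 1 + y2.
  by move: mR; rewrite mE1 pmulr_rgt0// mulr_gt0.
have lnE : ln (n N)%:R = ln N%:R + ln p + ln (1 + y1).
  by rewrite nE1 !lnM ?posrE// mulr_gt0.
have lmE : ln (N - n N)%:R = ln N%:R + ln q + ln (1 + y2).
  by rewrite mE1 !lnM ?posrE// mulr_gt0.
have C0 : 0 < 'C(N, n N)%:R :> R by rewrite ltr0n bin_gt0.
have lC : ln 'C(N, n N)%:R = ln N`!%:R - ln (n N)`!%:R - ln (N - n N)`!%:R :> R.
  rewrite -(bin_fact (hn N)) !natrM !lnM ?posrE ?mulr_gt0 ?ltr0n ?fact_gt0 ?bin_gt0//.
  by ring.
have b0 : 0 < binprob N by rewrite !mulr_gt0 ?exprn_gt0.
have pi0 := pi_gt0 R.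
have pi2 : 0 < 2 * pi :> R by rewrite mulr_gt0.
have s0 : 0 < 2 * pi * (p * q * N%:R) by rewrite mulr_gt0// pqN_gt0.
have ls : ln (Num.sqrt (2 * pi * (p * q * N%:R))) =
    (ln (2 * pi) + ln p + ln q + ln N%:R) / 2.
  rewrite -powR12_sqrt ?(ltW s0)// ln_powR !lnM ?posrE ?mulr_gt0//.
  by field.
rewrite !lnM ?posrE ?mulr_gt0 ?sqrtr_gt0 ?expR_gt0 ?exprn_gt0// expRK.
rewrite !lnXn// ls lC /stirling lnE lmE.
have pqN := delta_sqK N0.
have u2 : u N ^+ 2 = p * q * N%:R * (u N * delta N) ^+ 2.
  by rewrite exprMn mulrCA pqN mulr1.
rewrite u2 -[ln p *+ _]mulr_natr -[ln q *+ _]mulr_natr nE1 mE1.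
rewrite -[ln 2 + ln pi]lnM ?posrE// /y1 /y2.
have q1 : q = 1 - p by rewrite -pq1; ring.
set z := u N * delta N.
move: (ln (1 + - q * z)) (ln (1 + p * z)) => l1 l2.
move: (ln N`!%:R) (ln (n N)`!%:R) (ln (N - n N)%N`!%:R) => f1 f2 f3.
move: (ln N%:R) (ln (2 * pi)) (ln p) (ln q) => l3 l4 l5 l6.
by rewrite q1; field.
Qed.

Lemma cubic_cvg (c r : R) (y : nat -> R) (f : R -> R) :
  (forall N, y N = c * (u N * delta N)) ->
  (forall x, -1 < x -> `|f x| <= `|x| ^+ 3 / 2) ->
  N%:R * r * f (y N) @[N --> \oo] --> 0.
Proof.
move=> yE fE.
have y0 : y N @[N --> \oo] --> 0.
  rewrite -[X in _ --> X](mulr0 c).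
  by under eq_fun do rewrite yE; apply: cvgMl_tmp; exact: udelta_cvg.
apply/norm_cvg0P.
pose B := `|r| * `|c| ^+ 2 * (p * q)^-1 / 2 * M ^+ 2.
apply: (@squeeze_cvgr _ _ _ _ (cst 0) (fun N => B * `|y N|)).
- near=> N; rewrite normr_ge0 /=.
  have N0 : (0 < N)%N by near: N; exact: near_N_gt0.
  have uM : `|u N| <= M by near: N.
  have y1 : `|y N| <= 2^-1 by near: N; apply: cvg0_near => //; rewrite invr_gt0.
  rewrite !normrM.
  have Y : -1 < y N by move: y1; rewrite ler_norml => /andP[+ _]; lra.
  apply: (@le_trans _ _ (`|N%:R| * `|r| * (`|y N| ^+ 3 / 2))).
    by rewrite ler_wpM2l ?mulr_ge0// fE.
  have -> : `|N%:R| * `|r| * (`|y N| ^+ 3 / 2) =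
     `|r| * `|c| ^+ 2 * (p * q)^-1 / 2 * `|u N| ^+ 2 * `|y N|.
    rewrite exprS [in `|y N| ^+ 2]yE !normrM [`|delta N|]ger0_norm ?(ltW (delta_gt0 _))//.
    rewrite normr_nat !exprMn delta_sq//; field.
    by rewrite !gt_eqF// ltr0n.
  rewrite ler_wpM2r// ler_wpM2l//; last by rewrite lerXn2r// nnegrE (le_trans _ uM).
  by rewrite divr_ge0// !mulr_ge0 ?exprn_ge0// invr_ge0 mulr_ge0 ?ltW.
- exact: cvg_cst.
- rewrite -[X in _ --> X](mulr0 B); apply: cvgMl_tmp; exact/norm_cvg0P.
Unshelve. all: by end_near. Qed.

Lemma local_limit :
  binprob N * Num.sqrt (2 * pi * (p * q * N%:R)) * expR (u N ^+ 2 / 2)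
  @[N --> \oo] --> (1 : R).
Proof.
pose y1 N := - q * (u N * delta N); pose y2 N := p * (u N * delta N).
pose f (x : R) := (1 + x) * ln (1 + x) - (x + x ^+ 2 / 2).
pose S N := (stirling N - stirling (n N) - stirling (N - n N) + ln (2 * pi) / 2)
  - ln (1 + y1 N) / 2 - ln (1 + y2 N) / 2
  - N%:R * p * f (y1 N) - N%:R * q * f (y2 N) : R.
have y10 : y1 N @[N --> \oo] --> 0.
  by rewrite -[X in _ --> X](mulr0 (- q)); apply: cvgMl_tmp; exact: udelta_cvg.
have y20 : y2 N @[N --> \oo] --> 0.
  by rewrite -[X in _ --> X](mulr0 p); apply: cvgMl_tmp; exact: udelta_cvg.
have S0 : S N @[N --> \oo] --> 0.
  pose l : R := ln (2 * pi) / 2.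
  rewrite [X in _ --> X](_ : 0 = (l - l - l + l) - 0 / 2 - 0 / 2 - 0 - 0); last first.
    by rewrite mul0r !subr0 subrr sub0r addNr.
  apply: cvgB; last by apply: (@cubic_cvg p) => // x; exact: xlnx_quad.
  apply: cvgB; last by apply: (@cubic_cvg (- q)) => // x; exact: xlnx_quad.
  apply: cvgB; last by apply: cvgMr_tmp; exact: ln_near1.
  apply: cvgB; last by apply: cvgMr_tmp; exact: ln_near1.
  apply: cvgD; last exact: cvg_cst.
  apply: cvgB; first apply: cvgB.
  - exact: stirling_lim.
  - exact: (cvg_comp n (@stirling R) n_cvgy (@stirling_lim R)).
  - exact: (cvg_comp (fun N => N - n N)%N (@stirling R) m_cvgy (@stirling_lim R)).
have := cvg_continuous (@continuous_expR R 0) S0.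
rewrite expR0; apply: cvg_trans; apply: near_eq_cvg; near=> N.
have n0 : (0 < n N)%N.
  by near: N; have /cvgnyPge := n_cvgy; exact.
have m0 : (0 < N - n N)%N.
  by near: N; have /cvgnyPge := m_cvgy; exact.
have N0 : (0 < N)%N by exact: leq_trans n0 (hn N).
rewrite /= /S -ln_binprob// lnK// posrE !mulr_gt0 ?expR_gt0 ?exprn_gt0//.
  by rewrite ltr0n bin_gt0.
by rewrite sqrtr_gt0 !mulr_gt0 ?pi_gt0 ?ltr0n.
Unshelve. all: by end_near. Qed.

(** The prefactor of the statement without the power of h = q d; the sign and the
    power of q are the value of the complex exponential. *)
Definition amplitude N : R := (-1) ^+ n N * q ^- (N - n N) /
  Num.sqrt (2 * pi * (p * q * N%:R)) * expR (- (u N ^+ 2 / 4)).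

Definition kappa N x : R :=
  krawtchouk p q N (n N) x / (amplitude N * (q * delta N) `^ x).

(** * The asymptotics for x <= -2 *)

Section Base.
Context (a : R) (ha : 1 <= a).
Let nu : R := a + 1.
Notation mu := (@lebesgue_measure R).
Notation half := (`[0, +oo[%classic : set R).
Local Notation g a := (@moment R 0 a 1).
Notation ratio_prodN N := (ratio_prod p q nu (u N) (delta N)).
Notation term_ratioN N := (term_ratio p q nu (u N) (delta N)).

Let nu0 : 0 <= nu. Proof. by rewrite /nu; have := ha; lra. Qed.

Let ga0 : 0 < g a. Proof. exact: gamma_gt0. Qed.

Lemma term_ratioE N i : (0 < N)%N -> term_ratioN N i =
  ((n N)%:R - i%:R) * q / ((N%:R - (n N)%:R + nu + 1 + i%:R) * p).
Proof.
move=> N0; have K := delta_sqK N0.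
have D0 : 0 < delta N ^+ 2 by rewrite exprn_gt0// delta_gt0.
have nE1 : (n N)%:R * q * delta N ^+ 2 = 1 - q * (u N * delta N).
  rewrite n_scaled//.
  transitivity (p * q * N%:R * delta N ^+ 2 * (1 - q * (u N * delta N))); first by ring.
  by rewrite K mul1r.
have mE1 : (N%:R - (n N)%:R) * p * delta N ^+ 2 = 1 + p * (u N * delta N).
  rewrite -natrB// m_scaled//.
  transitivity (p * q * N%:R * delta N ^+ 2 * (1 + p * (u N * delta N))); first by ring.
  by rewrite K mul1r.
rewrite /term_ratio /tilt.
have -> : 1 - q * (u N * delta N + i%:R * delta N ^+ 2) =
   ((n N)%:R - i%:R) * q * delta N ^+ 2 by rewrite mulrDr opprD addrA -nE1; ring.
have -> : 1 + p * (u N * delta N + i%:R * delta N ^+ 2) + (nu + 1) * p * delta N ^+ 2 =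
   (N%:R - (n N)%:R + nu + 1 + i%:R) * p * delta N ^+ 2.
  by rewrite mulrDr addrA -mE1; ring.
by rewrite -mulf_div divff ?mulr1// gt_eqF.
Qed.

Lemma den_gt0 N i : 0 < N%:R - (n N)%:R + nu + 1 + i%:R.
Proof.
have : (n N)%:R <= N%:R :> R by rewrite ler_nat.
by have := nu0; have := ler0n R i; lra.
Qed.

Lemma gbinom_ratio_step N i : (0 < N)%N -> (i < n N)%N ->
  gbinom (N%:R + nu) (n N - i.+1) * q =
  term_ratioN N i * p * gbinom (N%:R + nu) (n N - i).
Proof.
move=> N0 ni; rewrite term_ratioE//.
have D := den_gt0 N i.
have := gbinomS (N%:R + nu) (n N - i.+1).
rewrite subnSK// natrB 1?ltnW// natrB// => E.
have {}E : gbinom (N%:R + nu) (n N - i.+1) * (N%:R - (n N)%:R + nu + 1 + i%:R) =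
    ((n N)%:R - i%:R) * gbinom (N%:R + nu) (n N - i).
  by rewrite E -natr1; ring.
apply: (@mulIf _ (N%:R - (n N)%:R + nu + 1 + i%:R)); first by rewrite gt_eqF.
rewrite mulrAC E; field.
by rewrite !gt_eqF.
Qed.

Lemma gbinom_ratio_prod N k : (0 < N)%N -> (k <= n N)%N ->
  gbinom (N%:R + nu) (n N - k) * q ^+ k * p ^+ (n N - k) =
  p ^+ n N * gbinom (N%:R + nu) (n N) * ratio_prodN N k.
Proof.
move=> N0; elim: k => [|k IH] kn.
  by rewrite subn0 /ratio_prod big_ord0; ring.
rewrite /ratio_prod big_ord_recr /= mulrA -/(ratio_prod _ _ _ _ _ k) -IH 1?ltnW//.
transitivity (gbinom (N%:R + nu) (n N - k.+1) * q * q ^+ k * p ^+ (n N - k.+1)).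
  by rewrite exprS; ring.
rewrite gbinom_ratio_step//.
have -> : p ^+ (n N - k) = p * p ^+ (n N - k.+1) by rewrite -exprS subnSK.
by ring.
Qed.

Lemma krawtchouk_neg N : (0 < N)%N ->
  krawtchouk p q N (n N) (- nu) =
  (-1) ^+ n N * p ^+ n N * gbinom (N%:R + nu) (n N) *
  \sum_(0 <= k < (n N).+1) rise nu k * ratio_prodN N k.
Proof.
move=> N0; rewrite /krawtchouk big_distrr /=.
apply: eq_big_nat => k /andP[_]; rewrite ltnS => kn.
transitivity ((-1) ^+ n N * rise nu k *
    (p ^+ n N * gbinom (N%:R + nu) (n N) * ratio_prodN N k)); last by ring.
rewrite -gbinom_ratio_prod// opprK (exprNn p) /rise.
have -> : (-1) ^+ n N = (-1) ^+ (n N - k) * (-1) ^+ k :> R.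
  by rewrite -exprD subnK.
have : (-1) ^+ k * (-1) ^+ k = 1 :> R by rewrite -expr2 sqrr_sign.
move: ((-1) ^+ k) => e ee.
transitivity (e * e * (gbinom (- nu) k * gbinom (N%:R + nu) (n N - k) * q ^+ k *
  ((-1) ^+ (n N - k) * p ^+ (n N - k)))); first by rewrite ee mul1r.
by ring.
Qed.

(** The factor of index n vanishes, so the sum over k <= n may be read as a sum
    over all k. *)
Lemma ratio_prod_oversize N k : (0 < N)%N -> (n N < k)%N -> ratio_prodN N k = 0.
Proof.
move=> N0 nk; rewrite /ratio_prod (bigD1 (Ordinal nk)) //= term_ratioE// subrr.
by rewrite !mul0r.
Qed.

Definition cell_weight N k : R := delta N `^ a * rise nu k * ratio_prodN N k.

Definition cell_sum N (s : R) : R := step (delta N) (n N).+1 (cell_weight N) s.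

Lemma cell_sumE N s : (0 < N)%N -> 0 <= s ->
  cell_sum N s = cell_weight N (Num.truncn (s / delta N)).
Proof.
move=> N0 s0; apply: stepE => //; first exact: delta_gt0.
by move=> k nk; rewrite /cell_weight ratio_prod_oversize// mulr0.
Qed.

Lemma trunc_cell N s : (0 < N)%N -> 0 <= s ->
  (Num.truncn (s / delta N))%:R * delta N <= s <
  ((Num.truncn (s / delta N))%:R + 1) * delta N.
Proof.
move=> N0 s0; have d0 := delta_gt0 N0.
have sd0 : 0 <= s / delta N by rewrite divr_ge0// ltW.
by rewrite -ler_pdivlMr// -ltr_pdivrMr// natr1 truncn_itv.
Qed.

(** The two-sided bounds on (nu)_k/k! with k = floor(s/d) are sharp enough to squeeze
    its rescaling between s^a and (s + nu d)^a. *)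
Lemma rise_cell_bounds N s (k := Num.truncn (s / delta N)) : (0 < N)%N -> 0 <= s ->
  s `^ a <= delta N `^ a * (rise nu k * g a) <= (s + nu * delta N) `^ a.
Proof.
move=> N0 s0; have d0 := delta_gt0 N0.
have /andP[ks sk] := trunc_cell N0 s0; rewrite -/k in ks sk.
have k1 : 0 <= k%:R + 1 :> R by rewrite addr_ge0.
have a0 : 0 <= a by have := ha; lra.
apply/andP; split.
  apply: (@le_trans _ _ (delta N `^ a * (k%:R + 1) `^ a)).
    rewrite -powRM ?(ltW d0)//.
    apply: ge0_ler_powR => //; rewrite ?nnegrE//.
      by rewrite mulr_ge0 ?(ltW d0).
    by rewrite mulrC ltW.
  by rewrite ler_wpM2l ?powR_ge0// rise_ge.
apply: (@le_trans _ _ (delta N `^ a * (k%:R + a + 1) `^ a)).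
  by rewrite ler_wpM2l ?powR_ge0// rise_le.
have h : 0 <= k%:R + a + 1 by rewrite !addr_ge0.
have e : delta N * (k%:R + a + 1) = k%:R * delta N + nu * delta N by rewrite /nu; ring.
rewrite -powRM ?(ltW d0)// e.
have h1 : 0 <= nu * delta N by rewrite mulr_ge0// ltW.
have h2 : 0 <= k%:R * delta N by rewrite mulr_ge0// ltW.
by apply: ge0_ler_powR; rewrite ?nnegrE ?addr_ge0// lerD2r.
Qed.

Lemma cell_sum_pointwise s : 0 <= s ->
  cell_sum N s - kern 2^-1 a (u N) s / g a @[N --> \oo] --> 0.
Proof.
move=> s0.
pose k N := Num.truncn (s / delta N).
pose A N := delta N `^ a * (rise nu (k N) * g a).
pose E N := expR (- (u N * s) - 2^-1 * s ^+ 2).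
pose r N := ratio_prodN N (k N) / E N.
have E0 N : 0 < E N by exact: expR_gt0.
have AS : A N @[N --> \oo] --> s `^ a.
  pose T N := (s + nu * delta N).
  apply: (@squeeze_cvgr _ _ _ _ (cst (s `^ a)) (fun N => s `^ a +
      a * nu * (s + nu) `^ (a - 1) * delta N)).
  - near=> N.
    have N0 : (0 < N)%N by near: N; exact: near_N_gt0.
    have d1 : `|delta N| <= 1 by near: N; apply: cvg0_near => //; exact: delta_cvg.
    have d0 := delta_gt0 N0; rewrite (gtr0_norm d0) in d1.
    have /andP[h1 h2] := rise_cell_bounds N0 s0.
    rewrite /cst /= h1 /= -lerBlDl; apply: le_trans (_ : T N `^ a - s `^ a <= _).
      by rewrite lerD2r.
    have nd : 0 < nu * delta N by rewrite mulr_gt0// /nu; have := ha; lra.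
    have sT : s <= T N by rewrite lerDl ltW.
    have T0 : 0 < T N by rewrite ltr_wpDl.
    apply: le_trans (powR_diff_le ha s0 sT T0) _.
    rewrite /T addrAC subrr add0r.
    rewrite [leRHS](_ : _ = a * (nu * delta N) * (s + nu) `^ (a - 1)); last by ring.
    have a0 : 0 <= a by have := ha; lra.
    have h3 : 0 <= a * (nu * delta N) by rewrite mulr_ge0// ltW.
    rewrite (ler_wpM2l h3)//.
    have a1 : 0 <= a - 1 by have := ha; lra.
    have sn : 0 <= s + nu by rewrite addr_ge0.
    apply: ge0_ler_powR; rewrite ?nnegrE ?(ltW T0)//.
    by rewrite lerD2l ler_piMr.
  - exact: cvg_cst.
  - rewrite -[X in _ --> X]addr0; apply: cvgD; first exact: cvg_cst.
    rewrite -[X in _ --> X](mulr0 (a * nu * (s + nu) `^ (a - 1))).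
    by apply: cvgMl_tmp; exact: delta_cvg.
have rS : r N @[N --> \oo] --> (1 : R).
  pose c := ratio_err nu M s.
  have e1 (b : R) : expR (b * delta N) @[N --> \oo] --> (1 : R).
    rewrite -[X in _ --> X](@expR0 R).
    apply: (@cvg_continuous _ (@expR R) (fun N => b * delta N)).
      exact: continuous_expR.
    by rewrite -[X in _ --> X](mulr0 b); apply: cvgMl_tmp; exact: delta_cvg.
  apply: (@squeeze_cvgr _ _ _ _ (fun N => expR (- c * delta N))
    (fun N => expR (c * delta N))); [|exact: e1|exact: e1].
  near=> N.
  have N0 : (0 < N)%N by near: N; exact: near_N_gt0.
  have d0 := delta_gt0 N0.
  have uM : `|u N| <= M by near: N.
  have M0 : 0 <= M by exact: le_trans uM.
  have small : (M + s) * delta N <= 2^-1.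
    have : `|(M + s) * delta N| <= 2^-1.
      near: N; apply: cvg0_near; last by rewrite invr_gt0.
      by rewrite -[X in _ --> X](mulr0 (M + s)); apply: cvgMl_tmp; exact: delta_cvg.
    by apply: le_trans; exact: ler_norm.
  have /andP[ks sk] := trunc_cell N0 s0.
  have /andP[h1 h2] := ratio_prod_near hp hq pq1 nu0 d0 uM ks sk small.
  rewrite /r ler_pdivlMr// ler_pdivrMr// -!expRD; apply/andP; split.
    by apply: le_trans h1; rewrite ler_expR mulNr addrC.
  by apply: le_trans h2 _; rewrite ler_expR addrC.
have : E N * ((A N * r N - s `^ a) / g a) @[N --> \oo] --> 0.
  apply: (@bounded_cvg0 _ _ (expR (M * s))).
    near=> N; have uM : `|u N| <= M by near: N.
    rewrite gtr0_norm// ler_expR.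
    have : `|u N * s| <= M * s by rewrite normrM (ger0_norm s0) ler_wpM2r.
    rewrite ler_norml => /andP[h _].
    by have := sqr_ge0 s; lra.
  rewrite -[X in _ --> X](mul0r (g a)^-1); apply: cvgMr_tmp.
  rewrite [X in _ --> X](_ : 0 = s `^ a * 1 - s `^ a); last by rewrite mulr1 subrr.
  by apply: cvgB; [exact: cvgM|exact: cvg_cst].
apply: cvg_trans; apply: near_eq_cvg; near=> N.
have N0 : (0 < N)%N by near: N; exact: near_N_gt0.
rewrite cell_sumE// /cell_weight /kern -/(k N) -/(E N) /A /r.
by field; rewrite !gt_eqF.
Unshelve. all: by end_near. Qed.

Let B : R := 3 / 2 + q^-1.
Let c0 : R := (2 * B)^-1.

Lemma cell_sum_dominated : exists C : R, \forall N \near \oo,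
  forall s, 0 <= s -> `|cell_sum N s| <= C * expR (- (s / 2)).
Proof.
have B0 : 0 < B by rewrite addr_gt0 ?invr_gt0// divr_gt0.
have c00 : 0 < c0 by rewrite invr_gt0 mulr_gt0.
(* K and C come from completing the square in 2 M s - c0 (s^2 - 3 s) + s. *)
pose K := (2 * M + 3 * c0 + 1) ^+ 2 / (4 * c0).
pose C := (2 * (a + 1)) `^ a * expR (nu / 2) * expR K / g a.
exists C; near=> N => s s0.
have N0 : (0 < N)%N by near: N; exact: near_N_gt0.
have d0 := delta_gt0 N0.
have uM : `|u N| <= M by near: N.
have a0 : 0 <= a by have := ha; lra.
have d1 : delta N <= 1.
  have : `|delta N| <= 1 by near: N; apply: cvg0_near => //; exact: delta_cvg.
  by apply: le_trans; exact: ler_norm.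
have small : M * delta N <= 2^-1.
  have : `|M * delta N| <= 2^-1.
    near: N; apply: cvg0_near; last by rewrite invr_gt0.
    by rewrite -[X in _ --> X](mulr0 M); apply: cvgMl_tmp; exact: delta_cvg.
  by apply: le_trans; exact: ler_norm.
rewrite cell_sumE//; set k := Num.truncn _.
have C0 : 0 <= C.
  by rewrite divr_ge0 ?(ltW ga0)// !mulr_ge0 ?powR_ge0 ?expR_ge0.
have [nk|kn] := ltnP (n N) k.
  by rewrite /cell_weight ratio_prod_oversize// mulr0 normr0 mulr_ge0 ?expR_ge0.
have /andP[ks sk] := trunc_cell N0 s0.
have num i : (i < k)%N -> 0 <= 1 - q * tilt (u N) (delta N) i /\
    i%:R * delta N ^+ 2 <= (p * q)^-1.
  move=> ik; have lin : (i <= n N)%N by exact: leq_trans (ltnW ik) kn.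
  have D0 : 0 < delta N ^+ 2 by rewrite exprn_gt0.
  split.
    have -> : 1 - q * tilt (u N) (delta N) i = ((n N)%:R - i%:R) * q * delta N ^+ 2.
      rewrite /tilt [RHS]mulrAC n_scaled//.
      transitivity (p * q * N%:R * delta N ^+ 2 * (1 - q * (u N * delta N)) -
        q * (i%:R * delta N ^+ 2)); last by ring.
      by rewrite delta_sqK//; ring.
    have h : 0 <= (n N)%:R - i%:R :> R by rewrite subr_ge0 ler_nat.
    by rewrite mulr_ge0 ?(ltW D0)// mulr_ge0// ltW.
  have pq0 : 0 <= (p * q)^-1 by rewrite invr_ge0 mulr_ge0// ltW.
  rewrite delta_sq// invfM mulrCA (ler_piMr pq0)//.
  by rewrite ler_pdivrMr ?ltr0n// mul1r ler_nat (leq_trans lin).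
have /andP[r0 r1] := ratio_prod_dom hp hq pq1 nu0 d0 uM ks sk d1 small num.
have /andP[A0 A1] := rise_cell_bounds N0 s0.
rewrite -/k in A0 A1 r0 r1.
have s1 : 0 <= s + nu by rewrite addr_ge0.
have A2 : delta N `^ a * (rise nu k * g a) <= (2 * (a + 1)) `^ a * expR ((s + nu) / 2).
  apply: le_trans A1 (le_trans _ (powR_le_exp a0 s1)).
  apply: ge0_ler_powR; rewrite ?nnegrE ?addr_ge0 ?mulr_ge0 ?(ltW d0)//.
  by rewrite lerD2l ler_piMr.
have A3 : 0 <= delta N `^ a * (rise nu k * g a) by apply: le_trans A0; exact: powR_ge0.
have -> : cell_weight N k = delta N `^ a * (rise nu k * g a) * ratio_prodN N k / g a.
  by rewrite /cell_weight; field; rewrite gt_eqF.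
rewrite ger0_norm; last by rewrite divr_ge0 ?(ltW ga0)// mulr_ge0.
rewrite /C [leRHS]mulrAC ler_wpM2r ?invr_ge0 ?(ltW ga0)//.
apply: le_trans (ler_pM A3 r0 A2 r1) _.
rewrite -!mulrA ler_wpM2l ?powR_ge0// -!expRD ler_expR.
have : 2 * M * s - c0 * (s ^+ 2 - 3 * s) <= K - s.
  have := sqr_ge0 (2 * c0 * s - (2 * M + 3 * c0 + 1)).
  rewrite sqrrB => h.
  rewrite -subr_ge0.
  have -> : K - s - (2 * M * s - c0 * (s ^+ 2 - 3 * s)) =
   (2 * c0 * s - (2 * M + 3 * c0 + 1)) ^+ 2 / (4 * c0).
    by rewrite /K; field; rewrite gt_eqF.
  by rewrite divr_ge0 ?sqr_ge0// mulr_ge0 ?(ltW c00).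
rewrite -/B -/c0; lra.
Unshelve. all: by end_near. Qed.

Lemma riemann_sum_cvg :
  delta N `^ nu * (\sum_(0 <= k < (n N).+1) rise nu k * ratio_prodN N k)
   - moment 2^-1 a (u N) / g a @[N --> \oo] --> 0.
Proof.
have a0 : 0 <= a by have := ha; lra.
have [C HC] := cell_sum_dominated.
pose K := 2^-1 * (1 + M) ^+ 2.
have mI : measurable (half : set (measurableTypeR R)).
  exact: measurable_itv.
have mk N : measurable_fun half (kern 2^-1 a (u N)).
  by apply: within_half_measurable; exact: kern_within.
have H : \int[mu]_(s in half) (cell_sum N s - kern 2^-1 a (u N) s / g a)
    @[N --> \oo] --> (0 : R).
  apply: (@dominated_cvg0 R (fun N s => cell_sum N s - kern 2^-1 a (u N) s / g a)
    (C + kern_cst a K / g a)).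
  - near=> N; apply: measurable_funB.
      have := @step_integrable R (delta N) (n N).+1 (cell_weight N).
      by move=> /(measurable_int mu)/measurable_EFinP.
    by apply: measurable_funM => //; exact: measurable_cst.
  - near=> N => s s0.
    have uM : `|u N| <= M by near: N.
    apply: le_trans (ler_normB _ _) _; rewrite mulrDl; apply: lerD.
      by move: s s0; near: N.
    rewrite normrM (gtr0_norm (_ : 0 < (g a)^-1)) ?invr_gt0// mulrAC.
    rewrite ler_wpM2r ?invr_ge0 ?(ltW ga0)//.
    by apply: kern_norm_le => //; exact: tame_gauss.
  - exact: cell_sum_pointwise.
move: H; apply: cvg_trans; apply: near_eq_cvg; near=> N.
have N0 : (0 < N)%N by near: N; exact: near_N_gt0.
have d0 := delta_gt0 N0.
have uM : `|u N| <= M by near: N.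
have ik := integrable_kern (tame_gauss uM) a0.
have ik' : mu.-integrable half (EFin \o (fun s => kern 2^-1 a (u N) s / g a)).
  have := integrableZl mI (g a)^-1 ik.
  by congr (_.-integrable _ _); apply/funext => s /=; rewrite -EFinM mulrC.
rewrite RintegralB//; last exact: step_integrable.
rewrite RintegralZr// Rintegral_step// big_distrr /=; congr (_ - _).
apply: eq_bigr => k _; rewrite /cell_weight.
have -> : delta N `^ nu = delta N * delta N `^ a by rewrite /nu powR_add1// ltW.
by ring.
Unshelve. all: by end_near. Qed.

(** N - n is asymptotic to q N. *)
Lemma shift_ratio (c1 c2 : R) :
  (((N%:R + c1) * q / ((N - n N)%:R + c2)) `^ nu) @[N --> \oo] --> (1 : R).
Proof.
have iN : N%:R^-1 @[N --> \oo] --> (0 : R).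
  by rewrite -(cvg_shiftS (fun N => N%:R^-1 : R)); exact: cvg_harmonic.
have H : (1 + c1 * N%:R^-1) / (1 + p * (u N * delta N) + c2 / q * N%:R^-1)
    @[N --> \oo] --> ((1 + c1 * 0) / (1 + p * 0 + c2 / q * 0) : R).
  apply: cvgM.
    by apply: cvgD; [exact: cvg_cst|exact: cvgMl_tmp].
  apply: cvgV; first by rewrite !mulr0 !addr0 oner_neq0.
  apply: cvgD; last exact: cvgMl_tmp.
  by apply: cvgD; [exact: cvg_cst|apply: cvgMl_tmp; exact: udelta_cvg].
rewrite !mulr0 !addr0 divr1 in H.
have cp : {for (1 : R), continuous (fun x : R => x `^ nu)}.
  apply: differentiable_continuous; apply/derivable1_diffP.
  by apply: derivable_powR; rewrite in_itv /= andbT.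
have := cvg_continuous cp H.
rewrite powR1; apply: cvg_trans; apply: near_eq_cvg; near=> N.
have N0 : (0 < N)%N by near: N; exact: near_N_gt0.
have NR : N%:R != 0 :> R by rewrite pnatr_eq0 -lt0n.
have qn : q != 0 by rewrite gt_eqF.
congr (_ `^ _).
have -> : 1 + c1 * N%:R^-1 = (N%:R + c1) * q / (N%:R * q).
  by field; rewrite NR qn.
have -> : 1 + p * (u N * delta N) + c2 / q * N%:R^-1 =
    ((N - n N)%:R + c2) / (N%:R * q).
  by rewrite m_scaled//; field; rewrite NR qn.
by rewrite invf_div mulrA divfK// mulf_neq0.
Unshelve. all: by end_near. Qed.

(** By [gbinom_rise] this is a quotient of rising factorials at N and N - n, each
    squeezed between shifted powers. *)
Lemma gbinom_ratio :
  gbinom (N%:R + nu) (n N) / 'C(N, n N)%:R * q `^ nu @[N --> \oo] --> (1 : R).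
Proof.
have nu1 : 1 <= nu by rewrite /nu; have := ha; lra.
have gnu : 0 < g nu by exact: gamma_gt0.
apply: (@squeeze_cvgr _ _ _ _
  (fun N => ((N%:R + 1) * q / ((N - n N)%:R + (nu + 1))) `^ nu)
  (fun N => ((N%:R + (nu + 1)) * q / ((N - n N)%:R + 1)) `^ nu));
  [|exact: shift_ratio|exact: shift_ratio].
near=> N.
have N0 : (0 < N)%N by near: N; exact: near_N_gt0.
have C0 : 0 < 'C(N, n N)%:R :> R by rewrite ltr0n bin_gt0.
have E : gbinom (N%:R + nu) (n N) * rise (nu + 1) (N - n N) =
    'C(N, n N)%:R * rise (nu + 1) N.
  by have := gbinom_rise nu (N - n N) (n N); rewrite subnK.
have lN := rise_ge N nu1; have uN := rise_le N nu1.
have lm := rise_ge (N - n N) nu1; have um := rise_le (N - n N) nu1.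
have m1 : 0 < (N - n N)%:R + 1 :> R by rewrite ltr_wpDl.
have m2 : 0 < (N - n N)%:R + nu + 1 :> R by apply: ltr_wpDl => //; exact: addr_ge0.
have N1 : 0 < N%:R + 1 :> R by rewrite ltr_wpDl.
have N2 : 0 < N%:R + nu + 1 :> R by apply: ltr_wpDl => //; exact: addr_ge0.
have rm : 0 < rise (nu + 1) (N - n N) * g nu by apply: lt_le_trans lm; exact: powR_gt0.
have rN : 0 < rise (nu + 1) N * g nu by apply: lt_le_trans lN; exact: powR_gt0.
have rm0 : 0 < rise (nu + 1) (N - n N) by rewrite pmulr_lgt0 in rm.
have -> : gbinom (N%:R + nu) (n N) / 'C(N, n N)%:R * q `^ nu =
    (rise (nu + 1) N * g nu) * q `^ nu / (rise (nu + 1) (N - n N) * g nu).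
  have -> : gbinom (N%:R + nu) (n N) =
      'C(N, n N)%:R * rise (nu + 1) N / rise (nu + 1) (N - n N).
    by rewrite -E mulfK// gt_eqF.
  by field; rewrite !gt_eqF.
have pd (x y : R) : 0 < x -> 0 < y -> (x * q / y) `^ nu = x `^ nu * q `^ nu / y `^ nu.
  move=> x0 y0; have ix := ltW x0; have iy := ltW y0.
  rewrite powRM ?invr_ge0 ?mulr_ge0 ?(ltW hq)// powRM ?(ltW hq)//.
  by congr (_ * _); rewrite -(powR_inv1 iy) -powRrM mulN1r powRN.
have qn : 0 <= q `^ nu by exact: powR_ge0.
rewrite !(addrA _ nu 1) !pd//.
move: rm rN lN uN lm um.
move: (rise (nu + 1) N * g nu) (rise (nu + 1) (N - n N) * g nu) => r1 r2.
move=> rm rN lN uN lm um.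
apply/andP; split.
  apply: ler_pM; rewrite ?mulr_ge0 ?powR_ge0 ?invr_ge0 ?powR_ge0//.
    by rewrite ler_wpM2r.
  by rewrite lef_pV2 ?posrE ?powR_gt0.
apply: ler_pM; rewrite ?mulr_ge0 ?powR_ge0 ?invr_ge0 ?powR_ge0 ?(ltW rm) ?(ltW rN)//.
  by rewrite ler_wpM2r.
by rewrite lef_pV2 ?posrE ?powR_gt0.
Unshelve. all: by end_near. Qed.

Lemma kappa_base :
  kappa N (- nu) - pcf_base a (u N) @[N --> \oo] --> 0.
Proof.
have a0 : 0 <= a by have := ha; lra.
pose T N := delta N `^ nu * (\sum_(0 <= k < (n N).+1) rise nu k * ratio_prodN N k).
pose m N := moment 2^-1 a (u N) / g a.
pose L N := binprob N * Num.sqrt (2 * pi * (p * q * N%:R)) * expR (u N ^+ 2 / 2)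
   * (gbinom (N%:R + nu) (n N) / 'C(N, n N)%:R * q `^ nu).
have L1 : L N @[N --> \oo] --> (1 : R).
  rewrite -[X in _ --> X](mulr1 1).
  by apply: cvgM; [exact: local_limit|exact: gbinom_ratio].
have Tm : T N - m N @[N --> \oo] --> 0 by exact: riemann_sum_cvg.
pose K := 2^-1 * (1 + M) ^+ 2.
have mb : \forall N \near \oo, `|m N| <= kern_cst a K * 2 / g a.
  near=> N; have uM : `|u N| <= M by near: N.
  have m0 : 0 <= m N by rewrite divr_ge0 ?(ltW ga0)// moment_ge0.
  rewrite (ger0_norm m0) /m ler_wpM2r ?invr_ge0 ?(ltW ga0)//.
  by apply: moment_le => //; exact: tame_gauss.
have H : expR (- (u N ^+ 2 / 4)) * (L N * (T N - m N) + m N * (L N - 1))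
    @[N --> \oo] --> 0.
  apply: (@bounded_cvg0 _ _ 1).
    near=> N; rewrite gtr0_norm ?expR_gt0// -[leRHS](@expR0 R) ler_expR.
    by rewrite oppr_le0 divr_ge0 ?sqr_ge0.
  rewrite [X in _ --> X](_ : 0 = 1 * 0 + 0); last by rewrite mulr0 addr0.
  apply: cvgD; first exact: cvgM.
  apply: (@bounded_cvg0 _ _ (kern_cst a K * 2 / g a)) => //.
  rewrite [X in _ --> X](_ : 0 = 1 - 1); last by rewrite subrr.
  by apply: cvgB => //; exact: cvg_cst.
move: H; apply: cvg_trans; apply: near_eq_cvg; near=> N.
have N0 : (0 < N)%N by near: N; exact: near_N_gt0.
have d0 := delta_gt0 N0.
have C0 : 0 < 'C(N, n N)%:R :> R by rewrite ltr0n bin_gt0.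
have s0 : 0 < Num.sqrt (2 * pi * (p * q * N%:R)).
  by rewrite sqrtr_gt0 !mulr_gt0 ?pi_gt0 ?ltr0n.
suff -> : kappa N (- nu) = expR (- (u N ^+ 2 / 4)) * (L N * T N).
  by rewrite /pcf_base -/(m N); ring.
rewrite /kappa krawtchouk_neg// /amplitude /L /T /binprob.
have -> : (q * delta N) `^ (- nu) = (q `^ nu * delta N `^ nu)^-1.
  by rewrite powRN powRM ?(ltW hq) ?(ltW d0).
have -> : expR (u N ^+ 2 / 2) = expR (- (u N ^+ 2 / 4)) ^- 2.
  rewrite -expRM_natl -expRN; congr expR.
  by field.
have qm : q ^+ (N - n N) != 0 by rewrite expf_neq0// gt_eqF.
have qq : q `^ nu != 0 by rewrite gt_eqF// powR_gt0.
have dd : delta N `^ nu != 0 by rewrite gt_eqF// powR_gt0.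
have ee : expR (- (u N ^+ 2 / 4)) != 0 by rewrite gt_eqF// expR_gt0.
have sg : (-1) ^+ n N != 0 :> R by rewrite signr_eq0.
move: (\sum_(_ <= _ < _) _) (gbinom _ _) => Sg G.
by field; rewrite qm qq dd ee sg !gt_eqF.
Unshelve. all: by end_near. Qed.

End Base.
(** * Ascending in x *)

Lemma amplitude_neq0 N : (0 < N)%N -> amplitude N != 0.
Proof.
move=> N0; have s0 : 0 < Num.sqrt (2 * pi * (p * q * N%:R)).
  by rewrite sqrtr_gt0 !mulr_gt0 ?pi_gt0 ?ltr0n.
rewrite /amplitude !mulf_neq0 ?signr_eq0 ?invr_eq0 ?expf_neq0 ?gt_eqF ?expR_gt0//.
Qed.

Lemma kappa_rec N x : (0 < N)%N ->
  (1 - x * (p * q) * delta N ^+ 2) * kappa N (x + 1) =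
  (u N + (q - p) * x * delta N) * kappa N x - x * kappa N (x - 1).
Proof.
move=> N0; have d0 := delta_gt0 N0.
have h0 : 0 < q * delta N by rewrite mulr_gt0.
have An := amplitude_neq0 N0.
have hx : 0 < (q * delta N) `^ x by exact: powR_gt0.
have KN := delta_sqK N0.
have := @krawtchouk_rec _ p q pq1 N (n N) x.
rewrite /kappa.
have -> : (q * delta N) `^ (x + 1) = (q * delta N) `^ x * (q * delta N).
  by rewrite powRD ?powRr1 ?(ltW h0)// (gt_eqF h0) implybT.
have -> : (q * delta N) `^ (x - 1) = (q * delta N) `^ x / (q * delta N).
  by rewrite powRB ?powRr1 ?(ltW h0)// (gt_eqF h0) implybT.
have un : u N / delta N = p * N%:R - (n N)%:R.
  by rewrite hu -/(delta N) mulfK ?gt_eqF// mulrC.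
move: (krawtchouk _ _ _ _ (x + 1)) (krawtchouk _ _ _ _ x)
  (krawtchouk _ _ _ _ (x - 1)) (amplitude N) An ((q * delta N) `^ x) hx.
move=> K2 K1 K0 A An X hx E.
have pN : p * N%:R = (q * delta N ^+ 2)^-1.
  apply: (@mulIf _ (q * delta N ^+ 2)); first by rewrite gt_eqF// mulr_gt0// exprn_gt0.
  rewrite mulVf ?gt_eqF ?mulr_gt0 ?exprn_gt0//.
  by rewrite -[RHS]KN; ring.
have {}E : (1 - x * (p * q) * delta N ^+ 2) / (q * delta N ^+ 2) * K2 =
    (u N / delta N + (q - p) * x) * K1 - x * q * K0.
  have -> : (1 - x * (p * q) * delta N ^+ 2) / (q * delta N ^+ 2) = p * (N%:R - x).
    rewrite mulrBr pN; field; rewrite !gt_eqF//.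
  by rewrite E un; ring.
apply: (@mulIf _ (A * X / delta N)).
  by rewrite !mulf_eq0 invr_eq0 (negbTE An) (gt_eqF hx) (gt_eqF d0).
transitivity ((1 - x * (p * q) * delta N ^+ 2) / (q * delta N ^+ 2) * K2).
  by field; rewrite An !gt_eqF.
by rewrite E; field; rewrite An !gt_eqF.
Qed.

Lemma kappa_step x (f h : R -> R) (C : R) :
  (forall v, `|v| <= M -> `|f v| <= C /\ `|h v| <= C) ->
  kappa N x - f (u N) @[N --> \oo] --> 0 ->
  kappa N (x - 1) - h (u N) @[N --> \oo] --> 0 ->
  kappa N (x + 1) - (u N * f (u N) - x * h (u N)) @[N --> \oo] --> 0.
Proof.
move=> bnd k1 k0.
pose den N : R := 1 - x * (p * q) * delta N ^+ 2.
have d2 : delta N ^+ 2 @[N --> \oo] --> 0.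
  rewrite -[X in _ --> X](mulr0 (0 : R)).
  by under eq_fun do rewrite expr2; apply: cvgM; exact: delta_cvg.
have den1 : den N @[N --> \oo] --> (1 : R).
  rewrite -[X in _ --> X]subr0 -[X in _ - X](mulr0 (x * (p * q))).
  by apply: cvgB; [exact: cvg_cst|exact: cvgMl_tmp].
have fb : \forall N \near \oo, `|f (u N)| <= C.
  by near=> N; apply: (bnd _ _).1; near: N.
have hb : \forall N \near \oo, `|h (u N)| <= C.
  by near=> N; apply: (bnd _ _).2; near: N.
pose D N := u N * f (u N) - x * h (u N).
have Db : \forall N \near \oo, `|D N| <= M * C + `|x| * C.
  near=> N; have uM : `|u N| <= M by near: N.
  have f1 : `|f (u N)| <= C by near: N.
  have h1 : `|h (u N)| <= C by near: N.
  apply: le_trans (ler_normB _ _) _; rewrite !normrM; apply: lerD.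
    exact: ler_pM.
  by rewrite ler_wpM2l.
have H : (u N * (kappa N x - f (u N)) +
    ((q - p) * x * delta N * (kappa N x - f (u N)) +
     f (u N) * ((q - p) * x * delta N)) - x * (kappa N (x - 1) - h (u N)) +
    D N * (1 - den N)) / den N @[N --> \oo] --> 0.
  have dx : (q - p) * x * delta N @[N --> \oo] --> 0.
    by rewrite -[X in _ --> X](mulr0 ((q - p) * x)); apply: cvgMl_tmp; exact: delta_cvg.
  rewrite [X in _ --> X](_ : 0 = (0 + (0 * 0 + 0) - x * 0 + 0) / 1); last first.
    by rewrite !mulr0 !addr0 subrr mul0r.
  apply: cvgM; last by apply: cvgV => //; exact: oner_neq0.
  apply: cvgD; last first.
    apply: (@bounded_cvg0 _ _ (M * C + `|x| * C)) => //.
    rewrite [X in _ --> X](_ : 0 = 1 - 1); last by rewrite subrr.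
    by apply: cvgB => //; exact: cvg_cst.
  apply: cvgB; last exact: cvgMl_tmp.
  apply: cvgD; first by apply: (@bounded_cvg0 _ _ M).
  apply: cvgD; first exact: cvgM.
  exact: (@bounded_cvg0 _ _ C).
move: H; apply: cvg_trans; apply: near_eq_cvg; near=> N.
have N0 : (0 < N)%N by near: N; exact: near_N_gt0.
have dn : 2^-1 < den N by near: N; apply: (cvgr_gt (1 : R)) => //; lra.
have dn0 : den N != 0 by rewrite gt_eqF//; lra.
have := kappa_rec x N0; rewrite -/(den N) => E.
have -> : kappa N (x + 1) = ((u N + (q - p) * x * delta N) * kappa N x
    - x * kappa N (x - 1)) / den N by rewrite -E mulrC mulKf.
rewrite /D; move: (den N) dn0 => e e0; by field.
Unshelve. all: by end_near. Qed.

Lemma pcf_base_bounded a : 1 <= a -> exists C : R,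
  forall v, `|v| <= M -> `|pcf_base a v| <= C.
Proof.
move=> a1; have a0 : 0 <= a by lra.
have ga0 : 0 < @moment R 0 a 1 by exact: gamma_gt0.
exists (kern_cst a (2^-1 * (1 + M) ^+ 2) * 2 / moment 0 a 1) => v vM.
have m0 : 0 <= moment 2^-1 a v / moment 0 a 1 by rewrite divr_ge0 ?moment_ge0// ltW.
have P0 : 0 <= pcf_base a v by apply: mulr_ge0 => //; exact: expR_ge0.
rewrite (ger0_norm P0) /pcf_base.
apply: (@le_trans _ _ (1 * (moment 2^-1 a v / moment 0 a 1))).
  rewrite ler_wpM2r// -[leRHS](@expR0 R) ler_expR.
  by rewrite oppr_le0 divr_ge0 ?sqr_ge0.
rewrite mul1r ler_wpM2r ?invr_ge0 ?(ltW ga0)//.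
by apply: moment_le => //; exact: tame_gauss.
Qed.

(** Induction on j along the recurrence; boundedness of the limit functions on
    [-M, M] is carried along because [kappa_step] needs it. *)
Lemma kappa_cvg a j (x := j%:R - (a + 1)) : 1 <= a ->
  kappa N x - (pcf a j).1 (u N) @[N --> \oo] --> 0.
Proof.
move=> a1; rewrite /x {x}.
suff [_ []] : (exists C : R, forall v, `|v| <= M ->
      `|(pcf a j).1 v| <= C /\ `|(pcf a j).2 v| <= C) /\
    kappa N (j%:R - (a + 1)) - (pcf a j).1 (u N) @[N --> \oo] --> 0 /\
    kappa N (j%:R - (a + 1) - 1) - (pcf a j).2 (u N) @[N --> \oo] --> 0 by [].
have a2 : 1 <= a + 1 by lra.
elim: j => [|j].
  rewrite sub0r /=; split; last split.
  - have [C1 h1] := pcf_base_bounded a1; have [C2 h2] := pcf_base_bounded a2.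
    exists (Num.max C1 C2) => v vM.
    by split; rewrite le_max ?(h1 v vM) ?(h2 v vM) ?orbT.
  - exact: kappa_base.
  - have -> : - (a + 1) - 1 = - (a + 1 + 1) by ring.
    exact: kappa_base.
rewrite /=; case: (pcf a j) => f h /= [[C HC] [k1 k0]].
have -> : j.+1%:R - (a + 1) = j%:R - (a + 1) + 1 by rewrite -natr1; ring.
split; last by split; [exact: kappa_step HC k1 k0|rewrite addrK].
exists (Num.max C (M * C + `|j%:R - (a + 1)| * C)) => v vM.
have [h1 h2] := HC v vM; split; last by rewrite le_max h1.
rewrite le_max; apply/orP; right.
apply: le_trans (ler_normB _ _) _; rewrite !normrM; apply: lerD.
  exact: ler_pM.
by rewrite ler_wpM2l.
Qed.

End Setting.

(** * The complex form *)

Section Final.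
Context {R : realType}.

Lemma cvg_real_complex (a : nat -> R) : a N @[N --> \oo] --> 0 ->
  ((a N)%:C : R[i]^o) @[N --> \oo] --> (0 : R[i]^o).
Proof.
move=> /cvgr0Pnorm_le a0; apply/cvgr0Pnorm_le => e e0.
have e1 : e = (complex.Re e)%:C by case: e e0 => e' i; rewrite ltcE /= => /andP[/eqP -> _].
have e2 : 0 < complex.Re e by move: e0; rewrite e1 ltcR.
near=> N.
have : `|a N| <= complex.Re e by near: N; exact: a0.
rewrite e1 -lecR => h; apply: le_trans h.
by rewrite normc_def /= expr0n /= addr0 sqrtr_sqr.
Unshelve. all: by end_near. Qed.

Lemma cos_sin_npi (m : nat) :
  cos (pi * m%:R) = (-1) ^+ m :> R /\ sin (pi * m%:R) = 0 :> R.
Proof.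
elim: m => [|m [c s]]; first by rewrite mulr0 cos0 sin0.
by rewrite -natr1 mulrDr mulr1 cosDpi sinDpi c s exprS mulN1r oppr0.
Qed.

Lemma cexp_rect (a b : R) :
  cexp (a%:C + b%:C * 'i%C) = (expR a)%:C * (cos b +i* sin b).
Proof.
rewrite /cexp; congr ((expR _)%:C * (cos _ +i* sin _)) => /=; ring.
Qed.

End Final.

Unset Implicit Arguments.
Set Strict Implicit.
Set Printing Implicit Defensive.

Theorem mainTheorem6 (R : realType) (p q : R)
  (hp0 : 0 < p) (hp1 : p < 1) (hq0 : 0 < q) (hq1 : q < 1) (hpq : p + q = 1)
  (x : R) (hx : 0 <= x)
  (n : nat -> nat) (hn : forall N : nat, (n N <= N)%N)
  (u : nat -> R)
  (hu : forall N : nat, u N = (N%:R * p - (n N)%:R) / Num.sqrt (p * q * N%:R))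
  (hbdd : exists M : R, \forall N \near \oo, `|u N| <= M) :
  exists e : nat -> R[i]^o,
    e @ \oo --> (0 : R[i]^o) /\
    \forall N \near \oo,
      let eps : R := N%:R^-1 in
      (krawtchouk p q N (n N) x)%:C =
        (Num.sqrt eps / Num.sqrt (2 * pi * p * q))%:C
        * (Num.sqrt (q * eps / p) `^ x)%:C
        * cexp ((pi%:C * 'i%C * p%:C - (q * ln q)%:C) / eps%:C
                - (u N)%:C * (Num.sqrt (p * q))%:C * (pi%:C * 'i%C + (ln q)%:C)
                  / (Num.sqrt eps)%:C
                - (u N ^+ 2 / 4)%:C)
        * ((parabolic_cylinder x (u N))%:C + e N).
Proof.
have [M hM] := hbdd.
(* Three steps more than the integer part put the starting point
   -(a + 1) = x - j at or below -2. *)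
pose j := (Num.truncn x).+3.
pose a : R := j%:R - x - 1.
have a1 : 1 <= a.
  have /andP[_] := truncn_itv hx.
  by rewrite /a /j -[X in X%:R - _]addn2 natrD => h; lra.
have xE : x = j%:R - (a + 1) by rewrite /a; ring.
have [L rf _] := @pcf_spec R a j a1; rewrite -xE in L rf.
have kc := @kappa_cvg R p q hp0 hq0 hpq n hn u hu M hM a j a1.
rewrite -xE in kc.
rewrite (parabolic_cylinderE (ladder_parabolic L rf)).
exists (fun N => (kappa p q n u N x - (pcf a j).1 (u N))%:C); split.
  exact: cvg_real_complex.
near=> N; pose eps : R := N%:R^-1; rewrite -/eps.
have N0 : (0 < N)%N by near: N; exact: nbhs_infty_gt.
have NR : 0 < N%:R :> R by rewrite ltr0n.
have d0 := delta_gt0 hp0 hq0 N0.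
have sq0 : 0 < Num.sqrt N%:R :> R by rewrite sqrtr_gt0.
have pq0 : 0 < p * q by rewrite mulr_gt0.
have spq : 0 < Num.sqrt (p * q) by rewrite sqrtr_gt0.
have se : Num.sqrt eps = (Num.sqrt N%:R)^-1 by rewrite /eps sqrtrV// ltW.
have un : u N * Num.sqrt (p * q) * Num.sqrt N%:R = N%:R * p - (n N)%:R.
  by rewrite hu sqrtrM ?(ltW pq0)// -mulrA divfK// mulf_neq0 ?gt_eqF.
have -> : ((pi%:C * 'i%C * p%:C - (q * ln q)%:C) / eps%:C
        - (u N)%:C * (Num.sqrt (p * q))%:C * (pi%:C * 'i%C + (ln q)%:C)
          / (Num.sqrt eps)%:C - (u N ^+ 2 / 4)%:C) =
    (- ((N - n N)%:R * ln q) - u N ^+ 2 / 4)%:C + (pi * (n N)%:R)%:C * 'i%C.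
  have -> : (n N)%:R = N%:R * p - u N * Num.sqrt (p * q) * Num.sqrt N%:R :> R.
    by rewrite un; ring.
  have -> : (N - n N)%:R = N%:R * q + u N * Num.sqrt (p * q) * Num.sqrt N%:R :> R.
    rewrite natrB// un; have -> : q = 1 - p by rewrite -hpq; ring.
    by ring.
  rewrite se /eps !(rmorphD, rmorphN, rmorphM) /= !fmorphV !invrK /=.
  by ring.
rewrite cexp_rect; have [-> ->] := @cos_sin_npi R (n N).
have -> : ((-1) ^+ n N +i* 0 : R[i]) = ((-1) ^+ n N)%:C by [].
rewrite -rmorphD addrCA subrr addr0 -!rmorphM /=; congr (_%:C).
have hE : Num.sqrt (q * eps / p) = q * delta p q N.
  have h0 : 0 <= q * delta p q N by rewrite mulr_ge0 ?ltW.
  rewrite -[RHS](ger0_norm h0) -sqrtr_sqr; congr Num.sqrt.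
  rewrite exprMn delta_sq// /eps; field.
  by rewrite !gt_eqF.
have hp2 : 0 < 2 * pi * p * q :> R by rewrite !mulr_gt0 ?pi_gt0.
have aE : amplitude p q n u N = Num.sqrt eps / Num.sqrt (2 * pi * p * q) *
    (expR (- ((N - n N)%:R * ln q) - u N ^+ 2 / 4) * (-1) ^+ n N).
  rewrite /amplitude expRD.
  have -> : expR (- ((N - n N)%:R * ln q)) = q ^- (N - n N).
    by rewrite expRN expRM_natl lnK// posrE.
  have -> : 2 * pi * (p * q * N%:R) = 2 * pi * p * q * N%:R by ring.
  rewrite se sqrtrM ?(ltW hp2)// invfM; ring.
have An := amplitude_neq0 hp0 hq0 n u N0.
have X0 : (q * delta p q N) `^ x != 0 by rewrite gt_eqF// powR_gt0// mulr_gt0.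
rewrite hE [_ * _ `^ x * _]mulrAC -aE /kappa.
by rewrite mulrC divfK// mulf_neq0.
Unshelve. all: by end_near. Qed.
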